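(* Let $K$ be an imaginary quadratic field, $f_\rho$ a positive integer, $\underline{\mathfrak c}=f_\rho\sqrt{D_K}\mathcal O_K$. Let $\chi$ be a character of $(\mathcal O_K/\underline{\mathfrak c})^\times$ with $\chi(u)=u$ for $u\in\mathcal O_K^\times$, and let $\varphi$ be a Hecke character of $K$ of infinity type $[-1/2;1,0]$ with conductor $\mathfrak c_f\mid\underline{\mathfrak c}$ whose finite character $\chi'_\varphi$, pulled back to $(\mathcal O_K/\underline{\mathfrak c})^\times$, equals $\chi^{-1}$. If $r$ is a positive integer for which there exists an integral ideal $\mathfrak q_r$ of $\mathcal O_K$ with $\mathrm{Nm}_{K/\mathbb Q}(\mathfrak q_r)=r$ and $\mathfrak q_r\mid\underline{\mathfrak c}\,\mathfrak c_f^{-1}$, then the oldform $\vartheta(\tau;\varphi)|[\mathrm{diag}(r,1)]_2=r\,\vartheta(r\tau;\varphi)$ lies in $F^{\chi^{-1}}(f_\rho)$.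
   Context: Embed $K\subset\mathbb C$ with $\sqrt{D_K}$ in the upper half plane $\mathcal H$; $D_K<0$ the discriminant, $h$ the class number. Hecke character of infinity type $[-1/2;1,0]$ with conductor $\mathfrak c_f$: a homomorphism $\varphi$ from fractional ideals prime to $\mathfrak c_f$ to $\mathbb C^\times$ with $\varphi(\alpha\mathcal O_K)=\alpha\chi'_\varphi(\alpha)$ for $\alpha\in\mathcal O_K$ prime to $\mathfrak c_f$, $\chi'_\varphi$ a character of $(\mathcal O_K/\mathfrak c_f)^\times$, $\mathfrak c_f$ minimal. $\vartheta(\tau;\varphi)=\sum_I\varphi(I)e^{2\pi i\tau\mathrm{Nm}(I)}$ over nonzero integral ideals ($\varphi(I)=0$ if $I$ not prime to $\mathfrak c_f$). For $f$ holomorphic on $\mathcal H$, $(f|[\mathrm{diag}(r,1)]_2)(\tau)=r f(r\tau)$. Let $z_1,\dots,z_h\in\mathcal H$ represent the $\mathbb C$-isomorphism classes of elliptic curves with CM by $\mathcal O_K$, $\mathfrak b_{z_a}=\mathbb Z+z_a\mathbb Z$; for $z=z_a$ let $(a_z,b_z,c_z)$ coprime, $a_z>0$, $a_zz^2+b_zz+c_z=0$. $\Lambda_a$: lattice with basis $e_2,e_1$ and Gram matrix $f_\rho\begin{pmatrix}2a_z&b_z\\ b_z&2c_z\end{pmatrix}$; $G_{\Lambda_a}=\Lambda_a^\vee/\Lambda_a$; $\Omega'_a$ the $\mathbb Q$-linear map with $\Omega'_a(e_2)=\sqrt{2a_zf_\rho}$, $\Omega'_a(e_1)=-\sqrt{2a_zf_\rho}z$;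 $\Omega_a=i\sqrt{|G_{\Lambda_a}|}(2a_zf_\rho)^{-1/2}\Omega'_a$ gives $G_{\Lambda_a}\cong\mathfrak b_{z_a}/\underline{\mathfrak c}\mathfrak b_{z_a}$, on which $(\mathcal O_K/\underline{\mathfrak c})^\times$ acts by multiplication ($g\cdot\beta$). $f_a(\tau;\beta)=\sum_{y\in\Lambda_a^\vee,\,y+\Lambda_a=\beta}\Omega'_a(y)e^{\pi if_\rho|D_K|\tau(y,y)}$. $F_a^{\chi^{-1}}$ is the span over $\beta_0\in G_{\Lambda_a}$ of $\sum_{g}\chi(g)f_a(\tau;g^{-1}\cdot\beta_0)$ (sum over $g\in(\mathcal O_K/\underline{\mathfrak c})^\times$), and $F^{\chi^{-1}}(f_\rho)=\sum_{a=1}^hF^{\chi^{-1}}_a$. *)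

(* Defs.v *)
From HB Require Import structures.
From mathcomp Require Import all_boot all_order all_algebra.
From mathcomp Require Import all_classical all_reals all_analysis.
From mathcomp Require Import complex.
Set Implicit Arguments. Unset Strict Implicit. Unset Printing Implicit Defensive.
Import Order.TTheory GRing.Theory Num.Theory.
Import numFieldNormedType.Exports.
Local Open Scope ring_scope.
Local Open Scope classical_set_scope.
Local Open Scope complex_scope.

(* Fundamental discriminants (imaginary quadratic fields K = Q(sqrt D)).    *)
Definition squarefree_int (m : int) : Prop :=
  forall d : int, (d * d %| m)%Z -> absz d = 1%N.

Definition neg_fund_disc (D : int) : Prop :=
  D < 0 /\
  ((((D %% 4)%Z = 1) /\ squarefree_int D) \/
   (exists m : int, D = 4 * m /\ ((m %% 4)%Z = 2 \/ (m %% 4)%Z = 3)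
                    /\ squarefree_int m)).

Section Defs.
Variable R : realType.
Local Notation C := (R[i]).
(* the same type, viewed as a numFieldType, to get its topology / limits *)
Definition Cnf : numFieldType := R[i].

Definition ofR (x : R) : C := x +i* 0.
Definition ofZ (n : int) : C := n%:~R.
Definition ofQ (q : rat) : C := ratr q.

Definition cexp (w : C) : C :=
  (expR (complex.Re w) * cos (complex.Im w)) +i* (expR (complex.Re w) * sin (complex.Im w)).

Definition sqrtD (D : int) : C := 0 +i* Num.sqrt (- (D%:~R : R)).
Definition omega (D : int) : C := (ofZ D + sqrtD D) / 2.
Definition OK (D : int) : set C :=
  [set x | exists m n : int, x = ofZ m + ofZ n * omega D].

Definition is_ideal (D : int) (I : set C) : Prop :=
  I `<=` OK D /\ I 0 /\ (exists x, I x /\ x != 0) /\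
  (forall x y, I x -> I y -> I (x - y)) /\
  (forall a x, OK D a -> I x -> I (a * x)).

Definition frac_ideal (D : int) (J : set C) : Prop :=
  exists d : int, d != 0 /\ is_ideal D [set ofZ d * x | x in J].

Definition idmul (I J : set C) : set C :=
  [set x | exists s : seq (C * C),
      (forall p, p \in s -> I p.1 /\ J p.2) /\ x = \sum_(p <- s) p.1 * p.2].

Definition pid (D : int) (a : C) : set C := [set a * x | x in OK D].

Definition coprime_id (I J : set C) : Prop :=
  exists x y, I x /\ J y /\ x + y = 1.

(* norm of an integral ideal = index [O_K : I] = |det| of a Z-basis of I
   expressed in the Z-basis (1, omega) of O_K *)
Definition ideal_norm (D : int) (I : set C) (n : nat) : Prop :=
  exists p q s t : int,
    I = [set x | exists m k : int,
           x = ofZ m * (ofZ p + ofZ q * omega D) + ofZ k * (ofZ s + ofZ t * omega D)]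
    /\ absz (p * t - q * s)%R = n.

Definition prime_to (D : int) (cf J : set C) : Prop :=
  frac_ideal D J /\
  exists I1 I2, is_ideal D I1 /\ is_ideal D I2 /\ coprime_id I1 cf /\
                coprime_id I2 cf /\ idmul J I2 = I1.

(* chi is a character of (O_K / m)^x, given as a function on O_K
   (only its values on elements prime to m matter) *)
Definition residue_char (D : int) (m : set C) (chi : C -> C) : Prop :=
  (forall a b, OK D a -> OK D b -> coprime_id (pid D a) m ->
     coprime_id (pid D b) m -> m (a - b) -> chi a = chi b) /\
  (forall a b, OK D a -> OK D b -> coprime_id (pid D a) m ->
     coprime_id (pid D b) m -> chi (a * b) = chi a * chi b) /\
  (forall a, OK D a -> coprime_id (pid D a) m -> chi a != 0).

(* phi is a Hecke character of infinity type [-1/2;1,0] with conductor cf and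
   finite character chi' : phi(alpha O_K) = alpha chi'(alpha); cf is minimal,
   i.e. chi' does not factor through (O_K/c')^x for any proper divisor c' of cf *)
Definition hecke_char (D : int) (cf : set C) (phi : set C -> C) (chi' : C -> C)
  : Prop :=
  is_ideal D cf /\ residue_char D cf chi' /\
  (forall J1 J2, prime_to D cf J1 -> prime_to D cf J2 ->
     phi (idmul J1 J2) = phi J1 * phi J2) /\
  (forall J, prime_to D cf J -> phi J != 0) /\
  (forall a, OK D a -> coprime_id (pid D a) cf -> phi (pid D a) = a * chi' a) /\
  (forall c', is_ideal D c' -> cf `<=` c' -> c' <> cf ->
     exists a b, [/\ OK D a, OK D b, coprime_id (pid D a) cf,
                     coprime_id (pid D b) cf & c' (a - b)] /\ chi' a != chi' b).

(* theta(tau; phi) = sum_I phi(I) e^{2 pi i tau Nm(I)}, summed by norm *)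
Definition theta_coef (D : int) (cf : set C) (phi : set C -> C) (n : nat) : C :=
  (\sum_(I \in [set I | is_ideal D I /\ ideal_norm D I n])
      (if `[< coprime_id I cf >] then phi I else 0))%R.

Definition theta (D : int) (cf : set C) (phi : set C -> C) (tau : C) : C :=
  limn (series (fun n : nat =>
    (theta_coef D cf phi n * cexp (2%:R * ofR pi * 'i * tau * n%:R) : Cnf))).

(* Lattices C/(Z + zZ) (complex elliptic curves) with CM by O_K             *)
Definition latt (w1 w2 : C) : set C :=
  [set x | exists m n : int, x = ofZ m * w1 + ofZ n * w2].
Definition latt_End (L : set C) : set C := [set a | forall x, L x -> L (a * x)].
Definition homothetic (L L' : set C) : Prop :=
  exists l : C, l != 0 /\ L' = [set l * x | x in L].

(* The lattice Lambda_a = Z e2 + Z e1 with Gram matrix f[[2a,b],[b,2c]];     *)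
(* vectors of Lambda_a (x) Q are pairs (y2, y1) of coordinates on (e2, e1). *)
Definition gram (f : nat) (A B Cc : int) (x y : rat * rat) : rat :=
  f%:R * (2%:R * A%:~R * x.1 * y.1 + B%:~R * (x.1 * y.2 + x.2 * y.1)
          + 2%:R * Cc%:~R * x.2 * y.2).

Definition in_lat (y : rat * rat) : Prop :=
  exists m n : int, y = (m%:~R, n%:~R).

Definition in_dual (f : nat) (A B Cc : int) (y : rat * rat) : Prop :=
  (exists k : int, gram f A B Cc y (1, 0) = k%:~R) /\
  (exists k : int, gram f A B Cc y (0, 1) = k%:~R).

(* |G_Lambda| = |Lambda^vee / Lambda| = |det Gram| *)
Definition disc_order (f : nat) (A B Cc : int) : nat :=
  absz ((f%:Z * f%:Z) * (4 * A * Cc - B * B))%R.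

Definition Omega' (f : nat) (A : int) (z : C) (y : rat * rat) : C :=
  ofR (Num.sqrt (2%:R * A%:~R * f%:R)) * (ofQ y.1 - ofQ y.2 * z).

Definition Omega (f : nat) (A B Cc : int) (z : C) (y : rat * rat) : C :=
  'i * ofR (Num.sqrt (disc_order f A B Cc)%:R)
     * (ofR (Num.sqrt (2%:R * A%:~R * f%:R)))^-1 * Omega' f A z y.

Definition Z2sum (F : int -> int -> C) : C :=
  limn (fun N : nat =>
    (\sum_(i < N.*2.+1) \sum_(j < N.*2.+1)
        F (i%:Z - N%:Z) (j%:Z - N%:Z) : Cnf)).

(* f_a(tau; g^{-1} . [y0]), where alpha in O_K represents g in (O_K/c)^x.
   y ranges over Lambda^vee with g.(y + Lambda) = y0 + Lambda, i.e.
   alpha Omega(y) = Omega(y0) mod Omega(Lambda).  Since Lambda^vee is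
   contained in (1/d) Z^2 with d = |det Gram|, we sum over (1/d) Z^2. *)
Definition f_act (D : int) (f : nat) (A B Cc : int) (z : C) (a : C)
  (y0 : rat * rat) (tau : C) : C :=
  let d := (disc_order f A B Cc)%:R : rat in
  Z2sum (fun m n =>
    let y := (m%:~R / d, n%:~R / d) in
    if `[< in_dual f A B Cc y /\
           exists l, in_lat l /\
             a * Omega f A B Cc z y = Omega f A B Cc z y0 + Omega f A B Cc z l >]
    then Omega' f A z y *
         cexp (ofR pi * 'i * f%:R * ofZ (absz D) * tau * ofQ (gram f A B Cc y y))
    else 0).

Definition cbar (D : int) (f : nat) : set C := pid D (f%:R * sqrtD D).

(* sum_{g in (O_K/c)^x} chi(g) f_a(tau; g^{-1} . [y0]); the elements
   x + y omega with 0 <= x, y < N := f|D| run over O_K / N O_K, and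
   N O_K has index |D| in c, so each class of O_K/c is hit |D| times. *)
Definition F_gen (D : int) (f : nat) (chi : C -> C) (A B Cc : int) (z : C)
  (y0 : rat * rat) (tau : C) : C :=
  let N := (f * absz D)%N in
  ((absz D)%:R)^-1 *
  \sum_(x < N) \sum_(y < N)
     (let a := ofZ x%:Z + ofZ y%:Z * omega D in
      if `[< coprime_id (pid D a) (cbar D f) >]
      then chi a * f_act D f A B Cc z a y0 tau else 0).

End Defs.

(* Main.v *)
Require Import Defs.
From HB Require Import structures.
From mathcomp Require Import all_boot all_order all_algebra finmap.
From mathcomp Require Import all_classical all_reals all_analysis.
From mathcomp Require Import complex ring lra zify.
From mathcomp.analysis.showcase Require summability.
Import Order.TTheory GRing.Theory Num.Theory.
Import numFieldNormedType.Exports.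
Set Implicit Arguments. Unset Strict Implicit. Unset Printing Implicit Defensive.
Local Open Scope classical_set_scope.
Local Open Scope complex_scope.
Local Open Scope ring_scope.

(** Write [b = Z + Z z] for a CM lattice, [A] for the leading coefficient of the
    primitive form of [z], and [c = f sqrt(D) O_K].  The map [Omega] identifies the
    dual lattice with [b] and the lattice itself with [c b], so the generators of
    the span are [sum_w kappa w e(A |w|^2 tau) sum_(g w = w0 mod c b) chi(g)], with
    [w] in [b] and [g] in the units modulo [c].  If [psi] is a function on [b / c b]
    with [psi(g w) = chi(g)^-1 psi(w)], summing [psi(w0)] times the generator of [w0]
    over all classes [w0] gives a nonzero multiple of
    [sum_w psi(w) kappa w e(A |w|^2 tau)].

    Every ideal class contains an ideal prime to [c], because a primitive form
    represents an integer prime to any given level; hence [q b = mu M] with [M]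
    integral and prime to [c_f].  The integral ideals [I] are, up to units, in
    bijection with the pairs (class, [0 != alpha] in [M]) by [I M = alpha O_K], and
    [phi(I) phi(M) = alpha chi'(alpha)] when [I] is prime to [c_f].  So with
    [w = mu alpha] the theta series is a combination of the sums above for
    [psi(w) = chi'(w / mu)], extended by zero; this [psi] is periodic modulo [c b]
    because [c] is contained in [q c_f]. *)

(** * Integers and binary quadratic forms *)

Definition primitive_form (A B C : int) : Prop := gcdz (gcdz A B) C = 1.

Lemma primitive_form_Bezout (A B C : int) : primitive_form A B C ->
  exists u v t : int, u * A + v * B + t * C = 1.
Proof.
move=> primABC; have [u [v uvE]] := Bezoutz A B.
have [s [t stE]] := Bezoutz (gcdz A B) C.
by exists (s * u), (s * v), t; rewrite -primABC -stE -uvE; ring.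
Qed.

Lemma primitive_part (a b c : int) : a != 0 -> exists g A B C : int,
  [/\ g != 0, 0 < A, primitive_form A B C & [/\ a = g * A, b = g * B & c = g * C]].
Proof.
move=> a0; wlog a_gt0 : a b c a0 / 0 < a => [wlog_pos|].
  have [|a_le0] := ltP 0 a; first exact: wlog_pos.
  have [||g [A [B [C [g0 A0 prim [aE bE cE]]]]]] := wlog_pos (- a) (- b) (- c).
  - by rewrite oppr_eq0.
  - by rewrite oppr_gt0 lt_neqAle a0.
  - by exists (- g), A, B, C; split; rewrite ?oppr_eq0//; split; lia.
set g := gcdz (gcdz a b) c.
have [ga gb gc] : [/\ (g %| a)%Z, (g %| b)%Z & (g %| c)%Z].
  by have := dvdz_gcdl (gcdz a b) c; rewrite dvdz_gcd -/g => /andP[-> ->]; rewrite dvdz_gcdr.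
have g0 : g != 0 by apply: contraTneq ga => ->; rewrite dvd0z gt_eqF.
have g_gt0 : 0 < g by rewrite lt_def g0.
exists g, (a %/ g)%Z, (b %/ g)%Z, (c %/ g)%Z; split=> //.
- by rewrite -(pmulr_lgt0 _ g_gt0) divzK.
- have gcdzMg x y : gcdz x y * g = gcdz (x * g) (y * g) by rewrite -mulz_gcdl gtz0_abs.
  by apply: (mulIf g0); rewrite mul1r !gcdzMg !divzK.
- by split; rewrite mulrC divzK.
Qed.

Lemma dvdn_prod_primes (p N : nat) (P : pred nat) : prime p -> p \in primes N ->
  (p %| \prod_(l <- primes N | P l) l)%N = P p.
Proof.
move=> p_pr pN; case Pp : (P p); first by rewrite (big_rem p)//= Pp dvdn_mulr.
rewrite Euclid_dvd_prod// big_seq_cond big_has_cond; apply/negbTE/hasPn => l lN.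
have l_pr : prime l by move: lN; rewrite mem_primes => /andP[].
apply/negP => /andP[/andP[_ Pl]].
by rewrite dvdn_prime2// => /eqP pl; rewrite -pl Pp in Pl.
Qed.

Lemma coprime_prime_divisors (v N : nat) : (0 < N)%N ->
  {in primes N, forall p, ~~ (p %| v)%N} -> coprime v N.
Proof.
move=> N0 no_prime; apply: contraT => gcd_neq1.
have gcd_gt1 : (1 < gcdn v N)%N.
  by rewrite ltn_neqAle eq_sym gcd_neq1 gcdn_gt0 N0 orbT.
have p_dvd := pdiv_dvd (gcdn v N).
have /negP[] : ~~ (pdiv (gcdn v N) %| v)%N.
  by rewrite no_prime// mem_primes N0 pdiv_prime// (dvdn_trans p_dvd)// dvdn_gcdr.
exact: dvdn_trans p_dvd (dvdn_gcdl _ _).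
Qed.

(* [m] and [n] are products of primes of [N], chosen so that each prime of [N] divides
   all but one of the three monomials. *)
Lemma primitive_form_coprime_value (A B C : int) (N : nat) : (0 < N)%N ->
  primitive_form A B C ->
  exists m n : int, coprime (absz (A * m * m + B * m * n + C * n * n)) N.
Proof.
move=> N0 primABC.
pose m := \prod_(l <- primes N | (l %| absz A)%N && ~~ (l %| absz C)%N) l.
pose n := \prod_(l <- primes N | ~~ (l %| absz A)%N) l.
exists m%:Z, n%:Z; apply: coprime_prime_divisors => // p pN.
have p_pr : prime p by move: pN; rewrite mem_primes => /andP[].
have dvdpM (x y : int) : (p%:Z %| x * y)%Z = (p%:Z %| x)%Z || (p%:Z %| y)%Z.
  by rewrite !dvdzE/= abszM Euclid_dvdM.
have p_m : (p%:Z %| m%:Z)%Z = (p%:Z %| A)%Z && ~~ (p%:Z %| C)%Z.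
  by rewrite !dvdzE/= dvdn_prod_primes.
have p_n : (p%:Z %| n%:Z)%Z = ~~ (p%:Z %| A)%Z by rewrite !dvdzE/= dvdn_prod_primes.
change (~~ (p%:Z %| A * m%:Z * m%:Z + B * m%:Z * n%:Z + C * n%:Z * n%:Z)%Z).
have [pA|pA] := boolP (p%:Z %| A)%Z; last first.
  rewrite rpredDr ?dvdpM ?p_n ?pA ?orbT// rpredDr ?dvdpM ?p_n ?pA ?orbT//.
  by rewrite !negb_or p_m (negPf pA).
have [pC|pC] := boolP (p%:Z %| C)%Z; last first.
  have pABm : (p%:Z %| A * m%:Z * m%:Z + B * m%:Z * n%:Z)%Z.
    by rewrite rpredD// !dvdpM p_m pA pC ?orbT.
  by rewrite rpredDl// !dvdpM p_n pA (negPf pC).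
rewrite rpredDr ?dvdpM ?pC// rpredDl ?dvdpM ?pA// p_m p_n pA pC !orbF.
apply/negP => pB; have [u [v [t uvtE]]] := primitive_form_Bezout primABC.
have : (p%:Z %| u * A + v * B + t * C)%Z by rewrite !rpredD// dvdpM ?pA ?pB ?pC orbT.
by rewrite uvtE dvdzE/= dvdn1 => /eqP p1; rewrite p1 in p_pr.
Qed.

Lemma subgroup_mulrz (V : zmodType) (H : set V) (x : V) (m : int) :
  H 0 -> (forall y z, H y -> H z -> H (y - z)) -> H x -> H (x *~ m).
Proof.
move=> H0 HB Hx; have HN y : H y -> H (- y) by move=> Hy; rewrite -sub0r; exact: HB.
have HMn (k : nat) : H (x *+ k).
  by elim: k => [|k ih]; rewrite ?mulr0n// mulrSr -[x in _ + x]opprK; exact/HB/HN.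
by case: m => k; [exact: HMn|exact/HN/HMn].
Qed.

Lemma int_subgroup_cyclic (H : set int) : H 0 -> (forall m n, H m -> H n -> H (m - n)) ->
  (exists2 m, H m & m != 0) ->
  exists2 g, 0 < g & forall m, H m <-> exists a, m = a * g.
Proof.
move=> H0 HB [m0 Hm0 m0_neq0].
have HM m a : H m -> H (a * m) by rewrite mulrC -mulrzz; exact: subgroup_mulrz.
have ex_pos : exists k : nat, (0 < k)%N && `[< H k%:Z >].
  exists (absz m0); rewrite absz_gt0 m0_neq0/=; apply/asboolP.
  have [m_ge0|m_lt0] := leP 0 m0; [by rewrite gez0_abs|rewrite ltz0_abs//].
  by rewrite -mulN1r; exact: HM.
case: (ex_minnP ex_pos) => g /andP[g0 /asboolP Hg] g_min.
exists g%:Z => // m; split=> [Hm|[a ->]]; last exact: HM.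
exists (m %/ g)%Z; have mE := divz_eq m g.
have Hr : H (m %% g)%Z by rewrite /modz; exact/HB/HM.
have r_lt : (m %% g)%Z < g%:Z by rewrite ltz_pmod.
have r_ge0 : 0 <= (m %% g)%Z by rewrite modz_ge0// gt_eqF.
suff r0 : (m %% g)%Z = 0 by rewrite [LHS]mE r0 addr0.
apply: contraTeq r_lt => r_neq0; rewrite -leNgt -(gez0_abs r_ge0) lez_nat g_min//.
by rewrite absz_gt0 r_neq0 gez0_abs//; exact/asboolP.
Qed.

Lemma int_subgroup2_basis (H : int -> int -> Prop) (k : int) : k != 0 ->
  (forall m n m' n', H m n -> H m' n' -> H (m - m') (n - n')) -> H k 0 -> H 0 k ->
  exists g p t : int, g * t != 0 /\
    forall m n, H m n <-> exists a b, m = a * g + b * p /\ n = b * t.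
Proof.
move=> k0 HB Hk0 H0k.
have H00 : H 0 0 by have := HB _ _ _ _ Hk0 Hk0; rewrite !subrr.
have [g g0 gP] : exists2 g, 0 < g & forall m, H m 0 <-> exists a, m = a * g.
  by apply: int_subgroup_cyclic => //; [move=> m n /HB /[apply]; rewrite subr0|exists k].
have [t t0 tP] : exists2 t, 0 < t & forall n, (exists m, H m n) <-> exists b, n = b * t.
  apply: int_subgroup_cyclic; [by exists 0| |by exists k => //; exists 0].
  by move=> n n' [m Hmn] [m' Hmn']; exists (m - m'); exact: HB.
have [p Hpt] : exists p, H p t by apply/tP; exists 1; rewrite mul1r.
have HMp (b : int) : H (b * p) (b * t).
  have := @subgroup_mulrz _ (fun x : int * int => H x.1 x.2) (p, t) b H00.
  rewrite /= !raddfMz /= !mulrzz ![_ * b]mulrC; apply=> // -[m n] [m' n']; exact: HB.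
exists g, p, t; split; first by rewrite mulf_neq0 ?gt_eqF.
move=> m n; split=> [Hmn|[a [b [-> ->]]]].
  have [b nE] : exists b, n = b * t by apply/tP; exists m.
  have [a mE] : exists a, m - b * p = a * g.
    by apply/gP; have := HB _ _ _ _ Hmn (HMp b); rewrite nE subrr.
  by exists a, b; rewrite -mE subrK.
have Hag : H (a * g) 0 by apply/gP; exists a.
have := HB _ _ _ _ Hag (HMp (- b)); rewrite !mulNr !opprK.
by rewrite add0r.
Qed.

Lemma fund_disc_sqr_sub (D : int) : neg_fund_disc D -> exists e : int, D * D - D = 4 * e.
Proof.
move=> [_ [[D1 _]|[m [-> _]]]]; last by exists (4 * m * m - m); ring.
exists (D * (D %/ 4)%Z); rewrite -[in LHS](mulr1 D) -mulrA -mulrBr.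
by have := divz_eq D 4; rewrite D1; nia.
Qed.

Lemma fund_disc_gt1 (D : int) : neg_fund_disc D -> (1 < absz D)%N.
Proof. by move=> [D0 [[D1 _]|[m [DE _]]]]; lia. Qed.

Lemma int_parity (n : int) : exists p, n = 2 * p \/ n = 2 * p + 1.
Proof.
exists (n %/ 2)%Z; have := divz_eq n 2; have : (n %% 2)%Z = 0 \/ (n %% 2)%Z = 1 by lia.
by lia.
Qed.

Lemma fund_disc_sqr_factor (D n A B C : int) : neg_fund_disc D ->
  D = n * n * (B * B - 4 * A * C) -> absz n = 1%N.
Proof.
set Q := B * B - 4 * A * C => -[_ D_fund] DE.
have [k Qk] : exists k, Q = 4 * k \/ Q = 4 * k + 1.
  have [p [BE|BE]] := int_parity B; rewrite /Q BE.
    by exists (p * p - A * C); left; ring.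
  by exists (p * p + p - A * C); right; ring.
case: D_fund => [[_ sqfD]|[m [Dm [m4 sqfm]]]].
  by apply/sqfD/dvdzP; exists Q; rewrite DE mulrC.
have [p [nE|nE]] := int_parity n.
  have mE : m = p * p * Q by nia.
  have : absz p = 1%N by apply/sqfm/dvdzP; exists Q; rewrite mE mulrC.
  have mDiv := divz_eq m 4.
  move=> p1; have pp : p * p = 1 by nia.
  by rewrite pp in mE; lia.
have [q QE] : exists q, Q = 4 * q.
  exists (m - (p * p + p) * Q); nia.
by apply/sqfm/dvdzP; exists q; nia.
Qed.

(** * Unconditional summation *)

Lemma partition_fsbig (V : nmodType) (S T : choiceType) (f : S -> T) (P : set S) (F : S -> V) :
  finite_set P ->
  \sum_(s \in P) F s = \sum_(t \in f @` P) \sum_(s \in P `&` f @^-1` [set t]) F s.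
Proof.
move=> finP; under [RHS]eq_fsbigr do rewrite fsbig_mkcondr.
rewrite exchange_fsbig//; last exact: finite_image.
apply: eq_fsbigr => s; rewrite inE => Ps.
rewrite -(fsbig_widen [set f s])/=; first by rewrite fsbig_set1 mem_set.
  by move=> _ ->; exists s.
by move=> t [_ /= fst]; rewrite memNset// => tE; apply: fst.
Qed.

#[local] Existing Instance summability.totally_filter.

Section UnconditionalSum.
Variable K : numFieldType.
Implicit Types S T : choiceType.

Definition has_sum T (F : T -> K) (l : K) : Prop :=
  (fun A : {fset T} => \sum_(t <- A) F t) @ summability.totally --> l.

Lemma has_sumD T (F G : T -> K) l m :
  has_sum F l -> has_sum G m -> has_sum (fun t => F t + G t) (l + m).
Proof.
move=> Fl Gm; rewrite /has_sum; under eq_fun do rewrite big_split/=.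
exact: cvgD.
Qed.

Lemma has_sumZ T (c : K) (F : T -> K) l : has_sum F l -> has_sum (fun t => c * F t) (c * l).
Proof.
move=> Fl; rewrite /has_sum; under eq_fun do rewrite -mulr_sumr.
exact: cvgMl_tmp.
Qed.

Lemma has_sum_sum T (I : Type) (r : seq I) (P : pred I) (F : I -> T -> K) (l : I -> K) :
  (forall i, P i -> has_sum (F i) (l i)) ->
  has_sum (fun t => \sum_(i <- r | P i) F i t) (\sum_(i <- r | P i) l i).
Proof.
move=> Fl; rewrite /has_sum; under eq_fun do rewrite exchange_big/=.
by apply: cvg_big => //; exact: add_continuous.
Qed.

Lemma has_sum_cvg T (F : T -> K) l (E : nat -> {fset T}) : has_sum F l ->
  (forall t, F t != 0 -> \forall n \near \oo, t \in E n) ->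
  \sum_(t <- E n) F t @[n --> \oo] --> l.
Proof.
move=> Fl supp_E; apply/cvgrPdist_lt => e e0.
have /cvgrPdist_lt/(_ e e0)[A _ close_A] := Fl.
have : \forall n \near \oo, forall t, t \in enum_fset A -> F t != 0 -> t \in E n.
  elim: (enum_fset A) => [|t s sE]; first exact: nearW.
  have [Ft0|/supp_E tE] := eqVneq (F t) 0.
    by apply: filterS sE => n sEn t'; rewrite inE => /orP[/eqP->|/sEn//]; rewrite Ft0 eqxx.
  apply: filterS2 sE tE => n sEn tEn t'; rewrite inE => /orP[/eqP->//|]; exact: sEn.
apply: filterS => n A_sub.
rewrite (@big_fset_incl _ _ _ _ (E n) (E n `|` A)%fset).
- by apply: close_A; exact: fsubsetUr.
- exact: fsubsetUl.
- move=> t; rewrite in_fsetU => /orP[->//|tA]; apply: contraNeq; exact: A_sub.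
Qed.

Lemma has_sum_reindex S T (j : S -> T) (F : T -> K) l : injective j ->
  (forall t, F t != 0 -> exists s, j s = t) -> has_sum (F \o j) l -> has_sum F l.
Proof.
move=> inj_j supp_j Fjl; apply/cvgrPdist_lt => e e0.
have /cvgrPdist_lt/(_ e e0)[A _ close_A] := Fjl.
exists [fset j s | s in A]%fset => // B /= AB.
pose preB := fset_set (j @^-1` [set` B]).
have preBE s : (s \in preB) = (j s \in B).
  rewrite in_fset_set; first by apply/idP/idP; rewrite inE.
  apply: finite_preimage; last exact: finite_fset.
  by move=> ? ? _ _; exact: inj_j.
have -> : \sum_(t <- B) F t = \sum_(s <- preB) (F \o j) s.
  rewrite -(@big_imfset _ _ _ _ _ imfset_key j (mem preB) F)/=; last first.
    by move=> ? ? _ _; exact: inj_j.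
  apply/esym/big_fset_incl.
    by apply/fsubsetP => _ /imfsetP[s /= sB ->]; rewrite -preBE.
  move=> t tB; apply: contraNeq => /supp_j[s js]; apply/imfsetP; exists s => //=.
  by rewrite preBE js.
apply: close_A; apply/fsubsetP => s sA; rewrite preBE.
by apply: (fsubsetP AB); exact: in_imfset.
Qed.

Lemma has_sum_pair (I : finType) T (F : I -> T -> K) (l : I -> K) :
  (forall i, has_sum (F i) (l i)) ->
  has_sum (fun y : I * T => F y.1 y.2) (\sum_i l i).
Proof.
move=> Fl.
have -> : (fun y : I * T => F y.1 y.2) = fun y => \sum_i if i == y.1 then F i y.2 else 0.
  by apply/funext => y; rewrite -big_mkcond big_pred1_eq.
apply: has_sum_sum => i _; apply: (@has_sum_reindex _ _ (pair i)) => [s t [//]|[k t] /=|].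
  by have [->|] := eqVneq i k; [exists t|rewrite eqxx].
by rewrite (_ : _ \o _ = F i)//; apply/funext => t /=; rewrite eqxx.
Qed.

End UnconditionalSum.

Lemma ler_sum_fset_sub (K : numDomainType) (T : choiceType) (F : T -> K) (A B : {fset T}) :
  (A `<=` B)%fset -> (forall t, 0 <= F t) -> \sum_(t <- A) F t <= \sum_(t <- B) F t.
Proof.
move=> AB F0; rewrite [leRHS](big_fsetID _ (mem A)) /=.
have -> : [fset t in B | t \in A]%fset = A.
  by apply/fsetP => t; rewrite !inE andbC; apply/andb_idr/(fsubsetP AB).
by rewrite lerDl sumr_ge0.
Qed.

Section DominatedSum.
Variable R : realType.
Local Notation C := R[i].
Variable T : choiceType.

Lemma has_sum_nonneg (G : T -> R) (K : R) : (forall t, 0 <= G t) ->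
  (forall A : {fset T}, \sum_(t <- A) G t <= K) ->
  exists l, has_sum (fun t => (G t)%:C) l.
Proof.
move=> G0 GK; pose S := [set \sum_(t <- A) G t | A in [set: {fset T}]].
have supS : has_sup S.
  by split; [exists (\sum_(t <- fset0) G t), fset0|exists K => _ [A _ <-]].
exists (sup S)%:C; apply/cvgrPdist_lt => e e0.
have eE : e = (complex.Re e)%:C by rewrite RRe_real// gtr0_real.
have Re_e0 : 0 < complex.Re e by rewrite -ltcR -eE.
have [_ [A _ <-] A_near] := sup_adherent Re_e0 supS.
exists A => // B /= AB.
have sumS (D : {fset T}) : S (\sum_(t <- D) G t) by exists D.
have AB_le : \sum_(t <- A) G t <= \sum_(t <- B) G t by exact: ler_sum_fset_sub.
rewrite -rmorph_sum/= -rmorphB normc_def/= expr0n addr0 sqrtr_sqr eE ltcR.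
rewrite ger0_norm ?subr_ge0 ?ub_le_sup//; last by case: supS.
by rewrite ltrBlDl -ltrBlDr (lt_le_trans A_near).
Qed.

Lemma has_sum_dominated (F : T -> C) (G : T -> R) (K : R) : (forall t, `|F t| <= (G t)%:C) ->
  (forall A : {fset T}, \sum_(t <- A) G t <= K) -> exists l, has_sum F l.
Proof.
move=> FG GK.
have G0 t : 0 <= G t by rewrite -ler0c (le_trans (normr_ge0 _) (FG t)).
have real_dominated (H : T -> R) : (forall t, `|H t| <= G t) ->
    exists l, has_sum (fun t => (H t)%:C) l.
  move=> HG; have [l Gl] := has_sum_nonneg G0 GK.
  have [m HGm] : exists m, has_sum (fun t => (H t + G t)%:C) m.
    apply: (@has_sum_nonneg _ (K + K)) => [t|A].
      by rewrite -lerBlDr sub0r lerNl (le_trans _ (HG t))// -normrN ler_norm.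
    rewrite big_split lerD// (le_trans _ (GK A))// ler_sum// => t _.
    exact: le_trans (ler_norm _) (HG t).
  exists (m + (-1) * l).
  have -> : (fun t => (H t)%:C) = fun t => (H t + G t)%:C + (-1) * (G t)%:C.
    by apply/funext => t; rewrite rmorphD mulN1r addrK.
  exact/has_sumD/has_sumZ.
have [a Re_a] : exists a, has_sum (fun t => (complex.Re (F t))%:C) a.
  by apply: real_dominated => t; rewrite -lecR (le_trans (normc_ge_Re _)).
have [b Im_b] : exists b, has_sum (fun t => (complex.Im (F t))%:C) b.
  apply: real_dominated => t; rewrite -lecR (le_trans _ (FG t))//.
  rewrite -[complex.Im _]opprK -ReiNIm normrN (le_trans (normc_ge_Re _))//.
  by rewrite normrM complexiE normCi mulr1.
exists (a + 'i%C * b).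
have -> : F = fun t => (complex.Re (F t))%:C + 'i%C * (complex.Im (F t))%:C.
  by apply/funext => t; rewrite -complexE.
exact/has_sumD/has_sumZ.
Qed.

End DominatedSum.

Definition box_point (N : nat) (ij : 'I_N.*2.+1 * 'I_N.*2.+1) : int * int :=
  (ij.1%:Z - N%:Z, ij.2%:Z - N%:Z).

Definition box (N : nat) : {fset int * int} := [fset @box_point N ij | ij in predT]%fset.

Lemma box_point_inj N : injective (@box_point N).
Proof. by move=> [i j] [k l] [/addIr [ik] /addIr [jl]]; congr pair; apply: val_inj. Qed.

Lemma mem_box N p : (p \in box N) = (absz p.1 <= N)%N && (absz p.2 <= N)%N.
Proof.
apply/imfsetP/andP => /= [[[i j] _ ->] /=|].
  by have := ltn_ord i; have := ltn_ord j; lia.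
case: p => m n /= [mN nN].
have ltmN : (absz (m + N%:Z)%R < N.*2.+1)%N by lia.
have ltnN : (absz (n + N%:Z)%R < N.*2.+1)%N by lia.
by exists (Ordinal ltmN, Ordinal ltnN) => //; congr pair => /=; lia.
Qed.

Lemma sub_box (A : {fset int * int}) : exists N, (A `<=` box N)%fset.
Proof.
exists (\max_(p <- A) maxn (absz p.1) (absz p.2))%N; apply/fsubsetP => p pA.
by rewrite mem_box -geq_max; apply: leq_bigmax_seq.
Qed.

Lemma sum_box (V : zmodType) (F : int * int -> V) N :
  \sum_(p <- box N) F p =
  \sum_(i < N.*2.+1) \sum_(j < N.*2.+1) F (i%:Z - N%:Z, j%:Z - N%:Z).
Proof.
rewrite big_imfset /=; last by move=> ? ? _ _; exact: box_point_inj.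
by rewrite big_enum pair_big.
Qed.

Section PlaneSums.
Variable R : realType.
Local Notation C := R[i].

Lemma cvg_Cnf_lim (u : nat -> Cnf R) (l : Cnf R) : u @ \oo --> l -> limn u = l.
Proof. by move=> ul; apply: cvg_lim => //; exact: norm_hausdorff. Qed.

Lemma Z2sum_has_sum (F : int -> int -> C) l : has_sum (fun p => F p.1 p.2) l -> Z2sum F = l.
Proof.
move=> Fl; apply: cvg_Cnf_lim; under eq_fun do rewrite -(sum_box (fun p => F p.1 p.2)).
apply: has_sum_cvg Fl _ => p _.
have [N /fsubsetP/(_ p)] := sub_box [fset p]%fset; rewrite inE eqxx => /(_ isT).
rewrite mem_box => pN; exists N => // n /= Nn; rewrite mem_box; lia.
Qed.

(* [4 m / (1 + |m|)] telescopes to a bounded sum and grows by at least [1 / (1 + m^2)]. *)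
Lemma inv1Dsqr_le_telescope (m : int) : (1 + m%:~R ^+ 2)^-1 <=
  4 * (m + 1)%:~R / (1 + `|(m + 1)%:~R|) - 4 * m%:~R / (1 + `|m%:~R|) :> R.
Proof.
rewrite intrD; have [m0|] := lerP 0 m.
  have : 0 <= m%:~R :> R by rewrite ler0z.
  move: m%:~R => x x0; rewrite !ger0_norm ?addr_ge0//.
  have [d1 d2 d3] : [/\ 0 < 1 + (x + 1), 0 < 1 + x & 0 < 1 + x ^+ 2] by split; nra.
  rewrite -subr_ge0.
  have -> : 4 * (x + 1) / (1 + (x + 1)) - 4 * x / (1 + x) - (1 + x ^+ 2)^-1 =
    (3 * x ^+ 2 - 3 * x + 2) / ((1 + (x + 1)) * (1 + x) * (1 + x ^+ 2)).
    by field; rewrite !gt_eqF.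
  by rewrite divr_ge0 ?mulr_ge0 ?ltW//; nra.
rewrite -lezD1 -(ler_int R) intrD.
move: m%:~R => x x1; rewrite !ler0_norm; [|lra|lra].
have [d1 d2 d3] : [/\ 0 < 1 - (x + 1), 0 < 1 - x & 0 < 1 + x ^+ 2] by split; nra.
rewrite -subr_ge0.
have -> : 4 * (x + 1) / (1 - (x + 1)) - 4 * x / (1 - x) - (1 + x ^+ 2)^-1 =
    (3 * x ^+ 2 + x + 4) / ((1 - (x + 1)) * (1 - x) * (1 + x ^+ 2)).
  by field; rewrite !gt_eqF.
by rewrite divr_ge0 ?mulr_ge0 ?ltW//; nra.
Qed.

Lemma sum_inv1Dsqr_le (N : nat) :
  \sum_(i < N.*2.+1) (1 + ((i%:Z - N%:Z)%:~R : R) ^+ 2)^-1 <= 8.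
Proof.
pose h (m : int) : R := 4 * m%:~R / (1 + `|m%:~R|).
have h4 m : `|h m| <= 4.
  rewrite /h normrM normfV normrM (ger0_norm (_ : 0 <= 4 :> R))//.
  rewrite (ger0_norm (_ : 0 <= 1 + _)) ?addr_ge0//.
  by rewrite ler_pdivrMr ?ltr_pwDl// ler_pM2l// lerDr.
apply: (@le_trans _ _ (\sum_(0 <= i < N.*2.+1) (h (i.+1%:Z - N%:Z) - h (i%:Z - N%:Z)))).
  rewrite big_mkord; apply: ler_sum => i _.
  have -> : i.+1%:Z - N%:Z = i%:Z - N%:Z + 1 by lia.
  exact: inv1Dsqr_le_telescope.
rewrite telescope_sumr// (le_trans (ler_norm _))// (le_trans (ler_normB _ _))//.
by apply: le_trans (lerD (h4 _) (h4 _)) _; lra.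
Qed.

Lemma sum_inv1Dsqr_pair_le (A : {fset int * int}) :
  \sum_(p <- A) ((1 + (p.1%:~R : R) ^+ 2)^-1 * (1 + (p.2%:~R : R) ^+ 2)^-1) <= 64.
Proof.
have inv_ge0 (m : int) : 0 <= (1 + (m%:~R : R) ^+ 2)^-1 by rewrite invr_ge0 addr_ge0 ?sqr_ge0.
have [N AN] := sub_box A; have sum_le := sum_inv1Dsqr_le N.
apply: le_trans (ler_sum_fset_sub AN _) _ => [p|]; first exact: mulr_ge0.
rewrite sum_box/= -big_distrlr/= (le_trans (ler_pM _ _ sum_le sum_le))//.
- exact: sumr_ge0.
- exact: sumr_ge0.
- by lra.
Qed.

Lemma expr1D_le_expR (k g : R) (n : nat) : (0 < n)%N -> 0 < k -> 0 <= g ->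
  (1 + g) ^+ n <= (1 + n%:R / k) ^+ n * expR (k * g).
Proof.
move=> n0 k0 g0; have n0' : n%:R != 0 :> R by rewrite pnatr_eq0 -lt0n.
have -> : k * g = (k * g / n%:R) * n%:R by rewrite divfK.
have nk0 : 0 <= n%:R / k by rewrite divr_ge0// ltW.
have kgn0 : 0 <= k * g / n%:R by rewrite divr_ge0// mulr_ge0// ltW.
rewrite expRM_natr -exprMn lerXn2r ?nnegrE ?addr_ge0 ?mulr_ge0 ?addr_ge0 ?expR_ge0//.
apply: (@le_trans _ _ ((1 + n%:R / k) * (1 + k * g / n%:R))); last first.
  by rewrite ler_wpM2l ?expR_ge1Dx ?addr_ge0.
have -> : (1 + n%:R / k) * (1 + k * g / n%:R) = 1 + g + (n%:R / k + k * g / n%:R).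
  by field; rewrite n0' gt_eqF.
by rewrite lerDl addr_ge0.
Qed.

Lemma gauss_le_inv1Dsqr (k c : R) : 0 < k -> 0 < c -> exists2 K : R, 0 <= K &
  forall t m n : R, 0 <= t -> m ^+ 2 + n ^+ 2 <= c * t ^+ 2 ->
    t * expR (- (k * t ^+ 2)) <= K * ((1 + m ^+ 2)^-1 * (1 + n ^+ 2)^-1).
Proof.
move=> k0 c0; exists ((1 + c) ^+ 2 * (1 + 3%:R / k) ^+ 3).
  by rewrite mulr_ge0 ?exprn_ge0 ?addr_ge0 ?divr_ge0 ?ltW.
move=> t m n t0 mnt; set g := t ^+ 2 in mnt *; have g0 : 0 <= g by exact: sqr_ge0.
have sqr1D x : 0 < 1 + x ^+ 2 :> R by rewrite ltr_pwDl ?sqr_ge0.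
have mn_le x : x ^+ 2 <= c * g -> 1 + x ^+ 2 <= (1 + c) * (1 + g).
  by move=> xcg; rewrite mulrDl mul1r mulrDr mulr1; lra.
have t_le : t <= 1 + g by rewrite /g; nra.
rewrite -invfM ler_pdivlMr ?mulr_gt0// expRN mulrAC ler_pdivrMr ?expR_gt0// -mulrA.
apply: le_trans (ler_wpM2l _ (expr1D_le_expR _ k0 g0)) => //; last exact: sqr_ge0.
have -> : (1 + c) ^+ 2 * (1 + g) ^+ 3 =
  (1 + g) * (((1 + c) * (1 + g)) * ((1 + c) * (1 + g))) by ring.
apply: ler_pM => //; first by rewrite mulr_ge0 ?(ltW (sqr1D _)).
apply: ler_pM; rewrite ?(ltW (sqr1D _))//; apply: mn_le; apply: le_trans mnt.
  by rewrite lerDl sqr_ge0.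
by rewrite lerDr sqr_ge0.
Qed.

Lemma has_sum_gauss (F : int * int -> C) (t : int * int -> R) (k c K : R) :
  0 < k -> 0 < c -> 0 <= K -> (forall p, 0 <= t p) ->
  (forall p, p.1%:~R ^+ 2 + p.2%:~R ^+ 2 <= c * t p ^+ 2) ->
  (forall p, `|F p| <= (K * (t p * expR (- (k * t p ^+ 2))))%:C) ->
  exists l, has_sum F l.
Proof.
move=> k0 c0 K0 t0 t_quad Ft; have [L L0 gaussL] := gauss_le_inv1Dsqr k0 c0.
pose G (p : int * int) := K * L * ((1 + (p.1%:~R : R) ^+ 2)^-1 * (1 + (p.2%:~R : R) ^+ 2)^-1).
apply: (@has_sum_dominated _ _ F G (K * L * 64)) => [p|A].
  by rewrite (le_trans (Ft p))// lecR /G -mulrA ler_wpM2l// gaussL.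
by rewrite -mulr_sumr ler_wpM2l ?mulr_ge0// sum_inv1Dsqr_pair_le.
Qed.

Lemma norm_cexp (u : C) : `|cexp u| = (expR (complex.Re u))%:C.
Proof.
rewrite normc_def /cexp /=; congr (_ %:C).
by rewrite !exprMn -mulrDr cos2Dsin2 mulr1 sqrtr_sqr ger0_norm ?expR_ge0.
Qed.

Lemma sqr_le_norm_comb (z : C) : complex.Im z != 0 -> exists2 c : R, 0 < c &
  forall m n : R, (m ^+ 2 + n ^+ 2)%:C <= c%:C * `|m%:C + n%:C * z| ^+ 2.
Proof.
case: z => x y /= y0; have y20 : 0 < y ^+ 2 by rewrite exprn_even_gt0.
exists (2 + (2 * x ^+ 2 + 1) / y ^+ 2) => [|m n].
  by rewrite addr_gt0// divr_gt0// ltr_wpDl// mulr_ge0 ?sqr_ge0.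
rewrite -add_Re2_Im2 -rmorphM lecR /= !(mul0r, mulr0, subr0, addr0, add0r).
set u := m + n * x; have -> : m = u - n * x by rewrite addrK.
have : 0 <= (2 * x ^+ 2 + 1) * u ^+ 2 / y ^+ 2.
  by apply: divr_ge0 (ltW y20); apply: mulr_ge0 (sqr_ge0 _); nra.
have -> : (2 + (2 * x ^+ 2 + 1) / y ^+ 2) * (u ^+ 2 + (n * y) ^+ 2) =
  2 * u ^+ 2 + 2 * (n * y) ^+ 2 + (2 * x ^+ 2 + 1) * n ^+ 2 +
  (2 * x ^+ 2 + 1) * u ^+ 2 / y ^+ 2.
  by field.
have := sqr_ge0 (u + n * x); have := sqr_ge0 (n * y); move: (_ / _) => q; nra.
Qed.

End PlaneSums.

(** * Complex numbers *)

Section ComplexNumbers.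
Variable R : realType.
Local Notation C := R[i].
Implicit Types z : C.

Lemma intr_complex (m : int) : (m%:~R : C) = (m%:~R : R)%:C.
Proof. by rewrite -(rmorph_int (real_complex R)). Qed.

Lemma ofQ_complex (q : rat) : ofQ R q = (ratr q : R)%:C.
Proof. by rewrite /ofQ -(fmorph_rat (real_complex R)). Qed.

Lemma real_comb_eq0 (x y : R) z : complex.Im z != 0 -> x%:C + y%:C * z = 0 -> x = 0 /\ y = 0.
Proof.
case: z => a b /= b0 [Re0 /eqP]; rewrite mul0r addr0 add0r mulf_eq0 (negPf b0) orbF => /eqP y0.
by move: Re0; rewrite y0 !mul0r subr0 addr0.
Qed.

Lemma int_comb_eq0 (m n : int) z : complex.Im z != 0 ->
  m%:~R + n%:~R * z = 0 -> m = 0 /\ n = 0.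
Proof.
rewrite !intr_complex => Im_z /(real_comb_eq0 Im_z)[/eqP + /eqP].
by rewrite !intr_eq0 => /eqP-> /eqP->.
Qed.

Lemma rat_comb_eq0 (p q : rat) z : complex.Im z != 0 ->
  ofQ R p + ofQ R q * z = 0 -> p = 0 /\ q = 0.
Proof.
rewrite !ofQ_complex => Im_z /(real_comb_eq0 Im_z)[/eqP + /eqP].
by rewrite !fmorph_eq0 => /eqP-> /eqP->.
Qed.

Lemma Im_neq0_conj z : complex.Im z != 0 -> z - z^* != 0.
Proof.
by case: z => a b /= b0; rewrite eq_complex /= subrr eqxx opprK -mulr2n mulrn_eq0.
Qed.

Lemma quadratic_root_conj (a b c z : C) : a != 0 -> a \is Num.real -> b \is Num.real ->
  c \is Num.real -> complex.Im z != 0 -> a * z ^+ 2 + b * z + c = 0 ->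
  z + z^* = - b / a /\ `|z| ^+ 2 = c / a.
Proof.
move=> a0 a_real b_real c_real Im_z root_z.
have root_zc : a * z^* ^+ 2 + b * z^* + c = 0.
  have := congr1 (@Num.conj C) root_z.
  rewrite !rmorphD !rmorphM conjC0 /=.
  by rewrite (conj_Creal a_real) (conj_Creal b_real) (conj_Creal c_real).
have trace_z : z + z^* = - b / a.
  apply: (mulfI a0); apply: (mulIf (Im_neq0_conj Im_z)); rewrite mulrCA divff// mulr1.
  have diff0 : a * z ^+ 2 + b * z + c - (a * z^* ^+ 2 + b * z^* + c) = 0.
    by rewrite root_z root_zc subrr.
  by apply/subr0_eq; rewrite -[RHS]diff0; ring.
split=> //; rewrite normCK; apply: (mulfI a0); rewrite [RHS]mulrCA divff// mulr1.
rewrite -(addr0_eq root_z); have -> : z^* = - b / a - z by rewrite -trace_z addrAC subrr add0r.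
by field.
Qed.

End ComplexNumbers.

Section SetProducts.
Variable R : realType.
Local Notation C := R[i].
Implicit Types (x y c d : C) (I J K L : set C).

Definition scal c L : set C := [set c * x | x in L].
Definition conjs L : set C := [set x^* | x in L].

Lemma scalA c d L : scal c (scal d L) = scal (c * d) L.
Proof.
apply/seteqP; split.
  by move=> _ [_ [x Lx <-] <-]; exists x => //; rewrite mulrA.
by move=> _ [x Lx <-]; exists (d * x); [exists x|rewrite mulrA].
Qed.

Lemma scal1 L : scal 1 L = L.
Proof.
apply/seteqP; split => x; first by move=> [y Ly <-]; rewrite mul1r.
by move=> Lx; exists x => //; rewrite mul1r.
Qed.

Lemma scalP c L x : c != 0 -> scal c L x <-> L (x / c).
Proof.
move=> c0; split; first by move=> [y Ly <-]; rewrite mulrC mulKf.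
by move=> Lxc; exists (x / c) => //; rewrite mulrC divfK.
Qed.

Lemma scal_inj c I J : c != 0 -> scal c I = scal c J -> I = J.
Proof. by move=> c0 /(congr1 (scal c^-1)); rewrite !scalA mulVf// !scal1. Qed.

Lemma conjsP L x : conjs L x <-> L x^*.
Proof.
split; first by move=> [y Ly <-]; rewrite conjCK.
by move=> Lx; exists x^* => //; rewrite conjCK.
Qed.

Lemma conjsK L : conjs (conjs L) = L.
Proof. by apply/seteqP; split => x /=; rewrite !conjsP conjCK. Qed.

Lemma conjs_scal c L : conjs (scal c L) = scal c^* (conjs L).
Proof.
apply/seteqP; split.
  by move=> _ [_ [x Lx <-] <-]; exists x^*; [exists x|rewrite rmorphM].
by move=> _ [_ [x Lx <-] <-]; exists (c * x); [exists x|rewrite rmorphM].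
Qed.

Lemma idmul0 I J : idmul I J 0.
Proof. by exists [::]; rewrite big_nil. Qed.

Lemma idmul_mem I J x y : I x -> J y -> idmul I J (x * y).
Proof.
by move=> Ix Jy; exists [:: (x, y)]; rewrite big_seq1; split=> // p; rewrite inE => /eqP ->.
Qed.

Lemma idmulD I J x y : idmul I J x -> idmul I J y -> idmul I J (x + y).
Proof.
move=> [s [sIJ ->]] [t [tIJ ->]]; exists (s ++ t); rewrite big_cat; split=> // p.
by rewrite mem_cat => /orP[/sIJ|/tIJ].
Qed.

Lemma idmul_ind K I J : K 0 -> (forall x y, K x -> K y -> K (x + y)) ->
  (forall x y, I x -> J y -> K (x * y)) -> idmul I J `<=` K.
Proof.
move=> K0 KD KM x [s [sIJ ->]]; rewrite big_seq.
by elim/big_ind : _ => // p /sIJ[]; exact: KM.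
Qed.

Lemma idmul_subset I I' J J' : I `<=` I' -> J `<=` J' -> idmul I J `<=` idmul I' J'.
Proof.
move=> II' JJ'; apply: idmul_ind => [|x y|x y /II' Ix /JJ' Jy].
- exact: idmul0.
- exact: idmulD.
- exact: idmul_mem.
Qed.

Lemma idmulC I J : idmul I J = idmul J I.
Proof.
suff sub (K L : set C) : idmul K L `<=` idmul L K by apply/seteqP; split; exact: sub.
apply: idmul_ind => [|x y|x y Kx Ly]; [exact: idmul0|exact: idmulD|].
by rewrite mulrC; exact: idmul_mem.
Qed.

Lemma idmulA I J K : idmul I (idmul J K) = idmul (idmul I J) K.
Proof.
have sub (I' J' K' : set C) : idmul I' (idmul J' K') `<=` idmul (idmul I' J') K'.
  apply: idmul_ind => [|x y|x y Ix]; [exact: idmul0|exact: idmulD|].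
  move: y; apply: (@idmul_ind (fun y => idmul (idmul I' J') K' (x * y))) => [|y z|y z Jy Kz].
  - by rewrite mulr0; exact: idmul0.
  - by rewrite mulrDr; exact: idmulD.
  - by rewrite mulrA; do 2?apply: idmul_mem.
apply/seteqP; split; first exact: sub.
rewrite (idmulC (idmul I J)) (idmulC I J) (idmulC I) (idmulC J K); exact: sub.
Qed.

Lemma idmul_scal c I J : idmul (scal c I) J = scal c (idmul I J).
Proof.
apply/seteqP; split.
  apply: idmul_ind.
  - by exists 0; [exact: idmul0|rewrite mulr0].
  - by move=> _ _ [x ? <-] [y ? <-]; exists (x + y); [exact: idmulD|rewrite mulrDr].
  - by move=> _ y [x ? <-] ?; exists (x * y); [exact: idmul_mem|rewrite mulrA].
move=> _ [x + <-]; move: x.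
apply: (@idmul_ind (fun x => idmul (scal c I) J (c * x))) => [|x y|x y Ix Jy].
- by rewrite mulr0; exact: idmul0.
- by rewrite mulrDr; exact: idmulD.
- by rewrite mulrA; apply: idmul_mem => //; exists x.
Qed.

Lemma idmul_scalr c I J : idmul I (scal c J) = scal c (idmul I J).
Proof. by rewrite idmulC idmul_scal idmulC. Qed.

Lemma conjs_idmul I J : conjs (idmul I J) = idmul (conjs I) (conjs J).
Proof.
have sub (K L : set C) : conjs (idmul K L) `<=` idmul (conjs K) (conjs L).
  move=> _ [x + <-]; move: x.
  apply: (@idmul_ind (fun x => idmul (conjs K) (conjs L) x^*)) => [|x y|x y Kx Ly].
  - by rewrite conjC0; exact: idmul0.
  - by rewrite rmorphD; exact: idmulD.
  - by rewrite rmorphM; apply: idmul_mem; [exists x|exists y].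
apply/seteqP; split; first exact: sub.
move=> x; rewrite -{1}(conjCK x) => IJx; apply/conjsP.
by rewrite -[I]conjsK -[J]conjsK; apply: sub; exists x => //; rewrite conjCK in IJx.
Qed.

End SetProducts.

(** * Modules over the ring of integers *)

Section ImaginaryQuadraticField.
Variables (R : realType) (D : int).
Hypothesis fund_D : neg_fund_disc D.
Local Notation C := R[i].
Local Notation sqrtD := (sqrtD R D).
Local Notation omega := (omega R D).
Local Notation OK := (@Defs.OK R D).
Local Notation pid := (@pid R D).
Local Notation is_ideal := (@is_ideal R D).
Local Notation ideal_norm := (@ideal_norm R D).
Implicit Types (x y c d z u : C) (I J K L M : set C).

Let D_lt0 : D < 0. Proof. by case: fund_D. Qed.

Lemma sqrtD_sqr : sqrtD * sqrtD = D%:~R.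
Proof.
rewrite intr_complex; apply/eqP; rewrite eq_complex /= !mul0r !mulr0 !add0r eqxx andbT.
by rewrite -expr2 sqr_sqrtr ?opprK// oppr_ge0 ltW// ltrz0.
Qed.

Lemma Im_sqrtD_gt0 : 0 < complex.Im sqrtD.
Proof. by rewrite /= sqrtr_gt0 oppr_gt0 ltrz0. Qed.

Lemma sqrtD_neq0 : sqrtD != 0.
Proof. by apply: contraTneq Im_sqrtD_gt0 => ->; rewrite ltxx. Qed.

Lemma conj_sqrtD : sqrtD^* = - sqrtD.
Proof. by apply/eqP; rewrite eq_complex /= oppr0 !eqxx. Qed.

Lemma absz_disc : (absz D)%:R = - D%:~R :> C.
Proof. by rewrite -mulrNz -[in RHS]ltz0_abs. Qed.

Lemma norm_sqrtD : `|sqrtD| ^+ 2 = (absz D)%:R.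
Proof. by rewrite normCK conj_sqrtD mulrN sqrtD_sqr absz_disc. Qed.

Lemma omega2E : omega * 2 = D%:~R + sqrtD.
Proof. by rewrite divfK// pnatr_eq0. Qed.

Lemma conj_omega : omega^* = D%:~R - omega.
Proof.
apply: (@mulIf _ (2 : C)); first by rewrite pnatr_eq0.
rewrite mulrBl omega2E -{1}(conjC_nat C 2) -rmorphM omega2E rmorphD/= rmorph_int conj_sqrtD.
ring.
Qed.

Lemma omega_sub_conj : omega - omega^* = sqrtD.
Proof. by rewrite conj_omega opprB addrA -mulr2n -mulr_natr omega2E addrAC subrr add0r. Qed.

Lemma Im_omega_neq0 : complex.Im omega != 0.
Proof.
apply: contraTneq Im_sqrtD_gt0; rewrite -omega_sub_conj.
by case: omega => a b /= ->; rewrite !oppr0 addr0 ltxx.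
Qed.

Lemma omega_quadratic : exists2 e : int, D * D - D = 4 * e &
  omega * omega = D%:~R * omega - e%:~R.
Proof.
have [e eE] := fund_disc_sqr_sub fund_D; exists e => //.
apply: (@mulfI _ (4 : C)); first by rewrite pnatr_eq0.
have -> : 4 * (omega * omega) = (omega * 2) * (omega * 2) by ring.
have -> : 4 * (D%:~R * omega - e%:~R) = 2 * D%:~R * (omega * 2) - (4 * e)%:~R :> C.
  by rewrite intrM; ring.
by rewrite -eE omega2E intrB intrM -sqrtD_sqr; ring.
Qed.

Lemma OK_int (m : int) : OK m%:~R.
Proof. by exists m, 0; rewrite /ofZ mul0r addr0. Qed.

Lemma OK0 : OK 0. Proof. exact: (OK_int 0). Qed.

Lemma OK1 : OK 1. Proof. exact: (OK_int 1). Qed.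

Lemma OK_omega : OK omega. Proof. by exists 0, 1; rewrite /ofZ add0r mul1r. Qed.

Lemma OKB x y : OK x -> OK y -> OK (x - y).
Proof. by move=> [m [n ->]] [k [l ->]]; exists (m - k), (n - l); rewrite /ofZ !intrB; ring. Qed.

Lemma OKD x y : OK x -> OK y -> OK (x + y).
Proof. by move=> OKx OKy; rewrite -[y]opprK -(sub0r y); exact/OKB/OKB/OKy/OK0. Qed.

Lemma OKM x y : OK x -> OK y -> OK (x * y).
Proof.
have [e _ omega2] := omega_quadratic; move=> [m [n ->]] [k [l ->]].
exists (m * k - n * l * e), (m * l + n * k + n * l * D).
rewrite /ofZ !(intrB, intrD, intrM); ring: omega2.
Qed.

Lemma OK_conj x : OK x -> OK x^*.
Proof.
move=> [m [n ->]]; exists (m + n * D), (- n).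
by rewrite /ofZ rmorphD rmorphM/= !rmorph_int conj_omega intrD intrM mulrNz; ring.
Qed.

Lemma OK_sqrtD : OK sqrtD.
Proof. by rewrite -omega_sub_conj; apply/OKB/OK_conj/OK_omega/OK_omega. Qed.

Lemma OK_norm x : OK x -> exists n : nat, `|x| ^+ 2 = n%:R.
Proof.
have [e _ omega2] := omega_quadratic; move=> [m [n xE]].
have normE : `|x| ^+ 2 = (m * m + m * n * D + n * n * e)%:~R.
  rewrite normCK xE /ofZ rmorphD rmorphM/= !rmorph_int conj_omega !(intrD, intrM); ring: omega2.
have := exprn_ge0 2 (normr_ge0 x); rewrite normE ler0z => /ZnatP[k ->]; by exists k.
Qed.

Lemma norm_OK_unit u : u != 0 -> OK u -> OK u^-1 -> `|u| ^+ 2 = 1.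
Proof.
move=> u0 /OK_norm[n nE] /OK_norm[k kE]; have := congr2 *%R nE kE.
rewrite -exprMn -normrM divff// normr1 expr1n -natrM => /esym/eqP.
by rewrite -[1]/(1%:R) eqr_nat muln_eq1 nE => /andP[/eqP->].
Qed.

Definition OKmod L : Prop :=
  [/\ L 0, forall x y, L x -> L y -> L (x - y) & forall a x, OK a -> L x -> L (a * x)].

Lemma OKmodN L x : OKmod L -> L x -> L (- x).
Proof. by move=> [L0 LB _] Lx; rewrite -sub0r; exact: LB. Qed.

Lemma OKmodD L x y : OKmod L -> L x -> L y -> L (x + y).
Proof.
by move=> modL Lx /(OKmodN modL) LNy; case: modL => _ LB _; rewrite -[y]opprK; exact: LB.
Qed.

Lemma OKmodMz L (m : int) x : OKmod L -> L x -> L (m%:~R * x).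
Proof. by move=> [_ _ LM]; exact/LM/OK_int. Qed.

Lemma OKmod_OK : OKmod OK.
Proof. by split; [exact: OK0|exact: OKB|exact: OKM]. Qed.

Lemma OKmod_scal c L : OKmod L -> OKmod (scal c L).
Proof.
move=> [L0 LB LM]; split.
- by exists 0 => //; rewrite mulr0.
- by move=> _ _ [x Lx <-] [y Ly <-]; exists (x - y); [exact: LB|rewrite mulrBr].
- by move=> a _ OKa [x Lx <-]; exists (a * x); [exact: LM|rewrite mulrCA].
Qed.

Lemma OKmod_pid c : OKmod (pid c).
Proof. exact/OKmod_scal/OKmod_OK. Qed.

Lemma OKmod_conjs L : OKmod L -> OKmod (conjs L).
Proof.
move=> [L0 LB LM]; split.
- by exists 0 => //; rewrite conjC0.
- by move=> _ _ [x Lx <-] [y Ly <-]; exists (x - y); [exact: LB|rewrite rmorphB].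
- move=> a _ OKa [x Lx <-]; exists (a^* * x); first exact/LM/Lx/OK_conj.
  by rewrite rmorphM/= conjCK.
Qed.

Lemma OKmod_idmul I J : OKmod I -> OKmod (idmul I J).
Proof.
move=> [_ _ IM]; have IJM a x : OK a -> idmul I J x -> idmul I J (a * x).
  move=> OKa; move: x; apply: (@idmul_ind _ (fun x => idmul I J (a * x))) => [|x y|x y Ix Jy].
  - by rewrite mulr0; exact: idmul0.
  - by rewrite mulrDr; exact: idmulD.
  - by rewrite mulrA; apply: idmul_mem => //; exact: IM.
split=> //; first exact: idmul0.
move=> x y IJx IJy; apply: idmulD => //; rewrite -mulN1r.
by apply: IJM => //; exact: (OK_int (-1)).
Qed.

Lemma idmul_OK L : OKmod L -> idmul L OK = L.
Proof.
move=> modL; apply/seteqP; split.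
  apply: idmul_ind => [|x y|x y Lx OKy]; [by case: modL|exact: OKmodD|].
  by rewrite mulrC; case: modL => _ _; exact.
by move=> x Lx; rewrite -[x]mulr1; apply: idmul_mem => //; exact: OK1.
Qed.

Lemma idmul_pid c L : OKmod L -> idmul L (pid c) = scal c L.
Proof. by move=> modL; rewrite idmul_scalr idmul_OK. Qed.

Lemma scal_pid c d : scal c (pid d) = pid (c * d).
Proof. exact: scalA. Qed.

Lemma pid_mem c : pid c c.
Proof. by exists 1; [exact: OK1|rewrite mulr1]. Qed.

Lemma pid_sub c L : OKmod L -> L c -> pid c `<=` L.
Proof. by move=> [_ _ LM] Lc _ [a OKa <-]; rewrite mulrC; exact: LM. Qed.

Lemma pid_eq_norm c d : c != 0 -> pid c = pid d -> `|c| ^+ 2 = `|d| ^+ 2.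
Proof.
move=> c0 cd; have d0 : d != 0.
  by apply: contra_neq c0 => d0; have := pid_mem c; rewrite cd d0 => -[y _ <-]; rewrite mul0r.
have OKdc : OK (d / c) by have := pid_mem d; rewrite -cd => /(scalP _ _ c0).
have OKcd : OK (d / c)^-1 by rewrite invf_div; have := pid_mem c; rewrite cd => /(scalP _ _ d0).
have dc0 : d / c != 0 by rewrite mulf_neq0 ?invr_eq0.
by have := norm_OK_unit dc0 OKdc OKcd; rewrite normf_div expr_div_n => /divr1_eq.
Qed.

Lemma pid_pos_inj c d : 0 < c -> 0 < d -> pid c = pid d -> c = d.
Proof.
move=> c0 d0 /pid_eq_norm -/(_ (lt0r_neq0 c0)) /eqP.
by rewrite eqrXn2// => /eqP; rewrite !gtr0_norm.
Qed.

(* [rho] is the positive generator of [L * conj L], that is, the norm of the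
   invertible module [L]; it is multiplicative without choosing any basis. *)
Definition rel_norm L (rho : C) : Prop :=
  [/\ OKmod L, 0 < rho & idmul L (conjs L) = pid rho].

Lemma rel_norm_unique L c d : rel_norm L c -> rel_norm L d -> c = d.
Proof. by move=> [_ c0 Lc] [_ d0 Ld]; apply: pid_pos_inj => //; rewrite -Lc -Ld. Qed.

Lemma rel_norm_idmul I J c d : rel_norm I c -> rel_norm J d -> rel_norm (idmul I J) (c * d).
Proof.
move=> [modI c0 Ic] [_ d0 Jd]; split; [exact: OKmod_idmul|exact: mulr_gt0|].
rewrite conjs_idmul idmulA -(idmulA I) (idmulC J) (idmulA I) Ic -idmulA Jd.
by rewrite idmul_pid ?scal_pid 1?mulrC//; exact: OKmod_pid.
Qed.

Lemma rel_norm_scal L c d : d != 0 -> rel_norm L c -> rel_norm (scal d L) (`|d| ^+ 2 * c).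
Proof.
move=> d0 [modL c0 Lc]; split; first exact: OKmod_scal.
  by rewrite mulr_gt0// exprn_gt0// normr_gt0.
by rewrite conjs_scal idmul_scal idmul_scalr scalA Lc scal_pid -normCK.
Qed.

Lemma rel_norm_conjs L c : rel_norm L c -> rel_norm (conjs L) c.
Proof. by move=> [modL c0 Lc]; split; [exact: OKmod_conjs| |rewrite conjsK idmulC]. Qed.

Lemma idmul_conjsK L c I : rel_norm L c -> OKmod I -> idmul (conjs L) (idmul L I) = scal c I.
Proof. by move=> [_ _ Lc] modI; rewrite idmulA (idmulC _ L) Lc idmulC idmul_pid. Qed.

Lemma latt_End_rel_norm L c : rel_norm L c -> latt_End L = OK.
Proof.
move=> [modL c0 Lc]; apply/seteqP; split => [x xL|x OKx y Ly]; last first.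
  by case: modL => _ _; exact.
have sub : idmul L (conjs L) `<=` [set y | pid c (x * y)].
  apply: (@idmul_ind _ [set y | pid c (x * y)]) => [|y y'|y y' Ly Ly'] /=.
  - by rewrite mulr0; case: (OKmod_pid c).
  - by rewrite mulrDr; apply: OKmodD => //; exact: OKmod_pid.
  - by rewrite mulrA -Lc; apply: idmul_mem => //; exact: xL.
have : pid c (x * c) by apply: sub; rewrite Lc; exact: pid_mem.
by move=> /(scalP _ _ (lt0r_neq0 c0)); rewrite mulfK ?lt0r_neq0.
Qed.

Lemma is_idealP I : is_ideal I <-> [/\ I `<=` OK, OKmod I & exists2 x, I x & x != 0].
Proof.
split; first by move=> [? [? [[x [? ?]] [? ?]]]]; split=> //; exists x.
by move=> [? [? ? ?] [x ? ?]]; do ?split => //; exists x.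
Qed.

Lemma is_ideal_sub I : is_ideal I -> I `<=` OK.
Proof. by case. Qed.

Lemma is_ideal_mod I : is_ideal I -> OKmod I.
Proof. by case/is_idealP. Qed.

Lemma is_ideal_OK : is_ideal OK.
Proof.
by apply/is_idealP; split; [|exact: OKmod_OK|exists 1; [exact: OK1|exact: oner_neq0]].
Qed.

Lemma is_ideal_conjs I : is_ideal I -> is_ideal (conjs I).
Proof.
move=> /is_idealP[IOK modI [x Ix x0]]; apply/is_idealP; split.
- by move=> _ [y /IOK OKy <-]; exact: OK_conj.
- exact: OKmod_conjs.
- by exists x^*; [exists x|rewrite conjC_eq0].
Qed.

Lemma is_ideal_idmul I J : is_ideal I -> is_ideal J -> is_ideal (idmul I J).
Proof.
move=> /is_idealP[IOK modI [x Ix x0]] /is_idealP[JOK _ [y Jy y0]]; apply/is_idealP; split.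
- apply: idmul_ind => [|u v|u v /IOK OKu /JOK]; [exact: OK0|exact: OKD|exact: OKM].
- exact: OKmod_idmul.
- by exists (x * y); [exact: idmul_mem|rewrite mulf_neq0].
Qed.

Lemma idmul_ideal_sub I L : is_ideal I -> OKmod L -> idmul I L `<=` L.
Proof.
move=> /is_ideal_sub IOK modL; rewrite -[X in _ `<=` X](idmul_OK modL) idmulC.
exact: idmul_subset.
Qed.

(* [x M^-1], as [M^-1 = conj M / m] when [m] is the norm of [M]. *)
Definition quot_ideal M (m : C) x : set C := scal (x / m) (conjs M).

Lemma quot_idealP M m x I : rel_norm M m -> OKmod I ->
  idmul I M = pid x <-> I = quot_ideal M m x.
Proof.
move=> normM modI; have [modM m_gt0 Mm] := normM; have m0 := lt0r_neq0 m_gt0; split=> [IMx|->].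
  apply: (scal_inj m0); rewrite -(idmul_conjsK normM modI) (idmulC M) IMx.
  by rewrite idmul_pid ?scalA 1?mulrC ?divfK//; exact: OKmod_conjs.
by rewrite idmul_scal idmulC Mm scal_pid divfK.
Qed.

Lemma rel_norm_quot_ideal M m x : rel_norm M m -> x != 0 ->
  rel_norm (quot_ideal M m x) (`|x| ^+ 2 / m).
Proof.
move=> normM x0; have [_ m_gt0 _] := normM; have m0 := lt0r_neq0 m_gt0.
have -> : `|x| ^+ 2 / m = `|x / m| ^+ 2 * m by rewrite normf_div (gtr0_norm m_gt0); field.
by apply: rel_norm_scal (rel_norm_conjs normM); rewrite mulf_neq0 ?invr_eq0.
Qed.

Lemma quot_ideal_is_ideal M m x : rel_norm M m -> M x -> x != 0 -> is_ideal (quot_ideal M m x).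
Proof.
move=> normM Mx x0; have [_ m_gt0 Mm] := normM.
have normQ := rel_norm_quot_ideal normM x0; apply/is_idealP; split.
- move=> _ [y My <-]; have : pid m (x * y) by rewrite -Mm; exact: idmul_mem.
  by move=> /(scalP _ _ (lt0r_neq0 m_gt0)); rewrite mulrAC.
- by case: normQ.
- exists (x / m * x^*); first by exists x^* => //; exists x.
  by rewrite mulf_neq0 ?conjC_eq0// mulf_neq0 ?invr_eq0// lt0r_neq0.
Qed.

(** * Lattices with complex multiplication *)

Lemma latt_l (w1 w2 : C) : latt w1 w2 w1.
Proof. by exists 1, 0; rewrite /ofZ mul0r addr0 mul1r. Qed.

Lemma latt_r (w1 w2 : C) : latt w1 w2 w2.
Proof. by exists 0, 1; rewrite /ofZ mul0r add0r mul1r. Qed.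

Lemma latt0 (w1 w2 : C) : latt w1 w2 0.
Proof. by exists 0, 0; rewrite /ofZ !mul0r addr0. Qed.

Lemma lattB (w1 w2 x y : C) : latt w1 w2 x -> latt w1 w2 y -> latt w1 w2 (x - y).
Proof. by move=> [m [n ->]] [k [l ->]]; exists (m - k), (n - l); rewrite /ofZ !intrB; ring. Qed.

Lemma latt_scal (w1 w2 : C) : w1 != 0 -> latt w1 w2 = scal w1 (latt 1 (w2 / w1)).
Proof.
move=> w1_neq0; apply/seteqP; split => x.
  move=> [m [n ->]]; exists (m%:~R + n%:~R * (w2 / w1)).
    by exists m, n; rewrite mulr1.
  by rewrite /ofZ; field.
by move=> [_ [m [n ->]] <-]; exists m, n; rewrite /ofZ; field.
Qed.

Lemma primitive_form_multiple (z : C) (A B Cc a b c : int) :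
  complex.Im z != 0 -> primitive_form A B Cc ->
  A%:~R * z ^+ 2 + B%:~R * z + Cc%:~R = 0 -> a%:~R * z ^+ 2 + b%:~R * z + c%:~R = 0 ->
  exists n, [/\ a = n * A, b = n * B & c = n * Cc].
Proof.
move=> Im_z /primitive_form_Bezout[u [v [t uvtE]]] root_A root_a.
have [CaAc BaAb] : Cc * a - A * c = 0 /\ B * a - A * b = 0.
  apply: (int_comb_eq0 Im_z); rewrite !(intrB, intrM).
  have -> : Cc%:~R * a%:~R - A%:~R * c%:~R + (B%:~R * a%:~R - A%:~R * b%:~R) * z =
    a%:~R * (A%:~R * z ^+ 2 + B%:~R * z + Cc%:~R)
    - A%:~R * (a%:~R * z ^+ 2 + b%:~R * z + c%:~R) by ring.
  by rewrite root_A root_a !mulr0 subrr.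
have BcCb : B * c - Cc * b = 0.
  suff [] : 0%Z = 0 /\ B * c - Cc * b = 0 by [].
  apply: (int_comb_eq0 Im_z); rewrite !(intrB, intrM) add0r.
  have -> : (B%:~R * c%:~R - Cc%:~R * b%:~R) * z =
    c%:~R * (A%:~R * z ^+ 2 + B%:~R * z + Cc%:~R)
    - Cc%:~R * (a%:~R * z ^+ 2 + b%:~R * z + c%:~R)
    + (Cc * a - A * c)%:~R * z ^+ 2 by rewrite intrB !intrM; ring.
  by rewrite root_A root_a CaAc !mulr0 mul0r subrr addr0.
pose n := u * a + v * b + t * c; exists n; split; rewrite -[LHS]mulr1 -uvtE.
- transitivity (n * A + v * (B * a - A * b) + t * (Cc * a - A * c)); first by rewrite /n; ring.
  by rewrite BaAb CaAc !mulr0 !addr0.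
- transitivity (n * B - u * (B * a - A * b) - t * (B * c - Cc * b)); first by rewrite /n; ring.
  by rewrite BaAb BcCb !mulr0 !subr0.
- transitivity (n * Cc - u * (Cc * a - A * c) + v * (B * c - Cc * b)); first by rewrite /n; ring.
  by rewrite CaAc BcCb !mulr0 subr0 addr0.
Qed.

(* The characteristic polynomial of multiplication by [omega] on the basis [(1, z)]
   has discriminant [D]. *)
Lemma omega_relation z : complex.Im z != 0 -> OKmod (latt 1 z) ->
  exists a b c : int, [/\ a != 0, a%:~R * z ^+ 2 + b%:~R * z + c%:~R = 0 &
    D = b * b - 4 * a * c].
Proof.
move=> Im_z [_ _ zM].
have [x [y]] := zM _ _ OK_omega (latt_l 1 z); rewrite /ofZ !mulr1 => omegaE.
have [u [v]] := zM _ _ OK_omega (latt_r 1 z); rewrite /ofZ mulr1 => omegazE.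
have [e De omega2] := omega_quadratic.
have [detE traceE] : x * v - y * u - e = 0 /\ D - (x + v) = 0.
  apply: (int_comb_eq0 Im_omega_neq0); rewrite !(intrB, intrD, intrM).
  have -> : x%:~R * v%:~R - y%:~R * u%:~R - e%:~R + (D%:~R - (x%:~R + v%:~R)) * omega =
    omega * omega - (y%:~R * (u%:~R + v%:~R * z) + x%:~R * omega)
    - v%:~R * (omega - (x%:~R + y%:~R * z)).
    by rewrite omega2; ring.
  rewrite -omegazE -omegaE subrr mulr0 subr0; apply/eqP; rewrite subr_eq0; apply/eqP.
  by rewrite {1}omegaE; ring.
exists y, (x - v), (- u); split.
- by apply: contraNneq Im_omega_neq0 => y0; rewrite omegaE y0 mul0r addr0 intr_complex.
- rewrite intrB mulrNz; move: omegazE; rewrite omegaE => omegazE.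
  have -> : y%:~R * z ^+ 2 + (x%:~R - v%:~R) * z - u%:~R =
    (x%:~R + y%:~R * z) * z - (u%:~R + v%:~R * z) by ring.
  by rewrite omegazE subrr.
- by move: De detE traceE; nia.
Qed.

Definition CM_form z (A B Cc : int) : Prop :=
  [/\ complex.Im z != 0, OKmod (latt 1 z), primitive_form A B Cc, 0 < A &
      A%:~R * z ^+ 2 + B%:~R * z + Cc%:~R = 0].

Lemma CM_form_exists z : complex.Im z != 0 -> OKmod (latt 1 z) ->
  exists A B Cc, CM_form z A B Cc.
Proof.
move=> Im_z mod_z; have [a [b [c [a0 root_z _]]]] := omega_relation Im_z mod_z.
have [g [A [B [Cc [g0 A0 prim [aE bE cE]]]]]] := primitive_part b c a0.
exists A, B, Cc; split=> //; apply: (@mulfI _ (g%:~R : C)); first by rewrite intr_eq0.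
by rewrite mulr0 -root_z aE bE cE !intrM; ring.
Qed.

Section CMForm.
Variables (z : C) (A B Cc : int).
Hypothesis formz : CM_form z A B Cc.

Let A_neq0 : (A%:~R : C) != 0.
Proof. by case: formz => _ _ _ A_gt0 _; rewrite intr_eq0 gt_eqF. Qed.
Let root_z : A%:~R * z ^+ 2 + B%:~R * z + Cc%:~R = 0. Proof. by case: formz. Qed.

Lemma CM_form_disc : B * B - 4 * A * Cc = D.
Proof.
have [Im_z mod_z prim _ _] := formz.
have [a [b [c [_ root_a DE]]]] := omega_relation Im_z mod_z.
have [n [aE bE cE]] := primitive_form_multiple Im_z prim root_z root_a.
have DnE : D = n * n * (B * B - 4 * A * Cc) by rewrite DE aE bE cE; ring.
have := fund_disc_sqr_factor fund_D DnE; nia.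
Qed.

Lemma CM_form_sqrtD : sqrtD = 2 * A%:~R * z + B%:~R \/ sqrtD = - (2 * A%:~R * z + B%:~R).
Proof.
have : sqrtD ^+ 2 == (2 * A%:~R * z + B%:~R) ^+ 2.
  rewrite expr2 sqrtD_sqr -CM_form_disc intrB !intrM -subr_eq0.
  have -> : B%:~R * B%:~R - 4%:~R * A%:~R * Cc%:~R - (2 * A%:~R * z + B%:~R) ^+ 2 =
    - 4 * A%:~R * (A%:~R * z ^+ 2 + B%:~R * z + Cc%:~R) by ring.
  by rewrite root_z mulr0.
by rewrite eqf_sqr => /orP[] /eqP; [left|right].
Qed.

Lemma CM_form_conj : z + z^* = - B%:~R / A%:~R /\ `|z| ^+ 2 = Cc%:~R / A%:~R.
Proof. by apply: quadratic_root_conj; rewrite ?realz//; case: formz. Qed.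

Lemma CM_form_OK : OK (A%:~R * z).
Proof.
have [q qE] : exists q, D + B = 2 * q.
  have [p [BE|BE]] := int_parity B; rewrite -CM_form_disc BE.
    by exists (2 * p * p + p - 2 * A * Cc); ring.
  by exists (2 * p * p + 3 * p + 1 - 2 * A * Cc); ring.
have qE' : 2 * q%:~R = D%:~R + B%:~R :> C by rewrite -intrD qE intrM.
have two0 : 2 != 0 :> C by rewrite pnatr_eq0.
have := omega2E; case: CM_form_sqrtD => -> omegaE.
  have -> : A%:~R * z = omega - q%:~R.
    apply: (mulfI two0); rewrite mulrBr qE' [2 * omega]mulrC omegaE; ring.
  exact/OKB/OK_int/OK_omega.
have -> : A%:~R * z = (D - q)%:~R - omega.
  apply: (mulfI two0); rewrite intrB 2!mulrBr qE' [2 * omega]mulrC omegaE; ring.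
exact/OKB/OK_omega/OK_int.
Qed.

Lemma rel_norm_CM_form : rel_norm (latt 1 z) (A%:~R)^-1.
Proof.
have [_ mod_z prim A0 _] := formz; have [trace_z norm_z] := CM_form_conj.
split=> //; first by rewrite invr_gt0 ltr0z.
have OKAzc : OK (A%:~R * z^*).
  by rewrite -(rmorph_int (@Num.conj C)) -rmorphM; exact/OK_conj/CM_form_OK.
apply/seteqP; split.
  apply: idmul_ind => [|x y|].
  - by case: (OKmod_pid (A%:~R)^-1).
  - by apply: OKmodD; exact: OKmod_pid.
  move=> _ _ [m [n ->]] [_ [k [l ->]] <-]; apply/scalP; first by rewrite invr_eq0.
  rewrite /ofZ invrK rmorphD !rmorphM /= !rmorph_int conjC1.
  have -> : (m%:~R * 1 + n%:~R * z) * (k%:~R * 1 + l%:~R * z^*) * A%:~R =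
    (A * m * k + n * l * Cc)%:~R + (m * l)%:~R * (A%:~R * z^*) + (n * k)%:~R * (A%:~R * z).
    rewrite intrD !intrM; have -> : Cc%:~R = z * z^* * A%:~R by rewrite -normCK norm_z divfK.
    by ring.
  apply: OKD; last exact/OKM/CM_form_OK/OK_int.
  by apply: OKD; [exact: OK_int|exact/OKM/OKAzc/OK_int].
have mod_zz : OKmod (idmul (latt 1 z) (conjs (latt 1 z))) by exact: OKmod_idmul.
have [l1 lz] := (latt_l 1 z, latt_r 1 z).
have [c1 cz] : conjs (latt 1 z) 1 /\ conjs (latt 1 z) z^*.
  by split; apply/conjsP; rewrite ?conjC1 ?conjCK.
have [u [v [t uvtE]]] := primitive_form_Bezout prim.
apply: pid_sub => //.
have -> : (A%:~R)^-1 = u%:~R * (1 * 1) - v%:~R * (z * 1 + 1 * z^*) + t%:~R * (z * z^*).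
  rewrite !mulr1 mul1r trace_z -normCK norm_z; apply: (mulfI A_neq0).
  by rewrite divff// -[LHS]/(1%:~R) -uvtE !intrD !intrM; field.
apply: (OKmodD mod_zz); last by apply: (OKmodMz _ mod_zz); exact: idmul_mem.
apply: (OKmodD mod_zz); first by apply: (OKmodMz _ mod_zz); exact: idmul_mem.
by apply: (OKmodN mod_zz); apply: (OKmodMz _ mod_zz); apply: idmulD; exact: idmul_mem.
Qed.

End CMForm.

Lemma latt_rel_norm (w1 w2 : C) :
  w1 != 0 -> complex.Im (w2 / w1) != 0 -> OKmod (latt w1 w2) ->
  exists (A B Cc : int) (rho : C), [/\ primitive_form A B Cc, rel_norm (latt w1 w2) rho,
    forall m n : int, `|m%:~R * w1 + n%:~R * w2| ^+ 2 =
      rho * (A * m * m + B * m * n + Cc * n * n)%:~R &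
    `|w2 * w1^* - w2^* * w1| = rho * `|sqrtD|].
Proof.
move=> w1_neq0 Im_z mod_w; set z := w2 / w1 in Im_z.
have w2E : w2 = w1 * z by rewrite mulrC divfK.
have mod_z : OKmod (latt 1 z).
  have -> : latt 1 z = scal w1^-1 (latt w1 w2).
    by rewrite (latt_scal _ w1_neq0) scalA mulVf// scal1.
  exact: OKmod_scal.
have [A [B [Cc formz]]] := CM_form_exists Im_z mod_z.
have [_ _ prim A0 _] := formz; have A0' : (A%:~R : C) != 0 by rewrite intr_eq0 gt_eqF.
have [trace_z norm_z] := CM_form_conj formz.
exists A, (- B), Cc, (`|w1| ^+ 2 * (A%:~R)^-1); split.
- by rewrite /primitive_form gcdzN.
- by rewrite (latt_scal _ w1_neq0); exact: rel_norm_scal (rel_norm_CM_form formz).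
- move=> m n; have -> : m%:~R * w1 + n%:~R * w2 = w1 * (m%:~R + n%:~R * z) by rewrite w2E; ring.
  rewrite normrM exprMn -[RHS]mulrA; congr (_ * _).
  rewrite normCK rmorphD rmorphM /= !rmorph_int.
  have -> : (m%:~R + n%:~R * z) * (m%:~R + n%:~R * z^*) =
    m%:~R * m%:~R + m%:~R * n%:~R * (z + z^*) + n%:~R * n%:~R * (z * z^*) by ring.
  by rewrite trace_z -normCK norm_z !(intrD, intrM) mulrNz; field.
- have -> : w2 * w1^* - w2^* * w1 = (w1 * w1^*) * (2 * A%:~R * z + B%:~R) / A%:~R.
    have -> : B%:~R = - A%:~R * (z + z^*) by rewrite trace_z; field.
    by rewrite w2E rmorphM /=; field.
  have normE : `|2 * A%:~R * z + B%:~R| = `|sqrtD|.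
    by case: (CM_form_sqrtD formz) => ->; rewrite ?normrN.
  rewrite -normCK normrM normfV normrM normE normrX normr_id mulrAC.
  by rewrite (gtr0_norm (_ : 0 < A%:~R)) ?ltr0z.
Qed.

(** * Norms and classes of ideals *)

Lemma ideal_norm_exists I : is_ideal I -> exists n, ideal_norm I n.
Proof.
move=> /is_idealP[IOK modI [x Ix x0]]; have [_ IB IM] := modI.
have [k kE] := OK_norm (IOK _ Ix).
have k0 : k%:Z != 0.
  by apply: contra_neq x0 => -[k0]; apply/eqP; rewrite -normr_eq0 -sqrf_eq0 kE k0.
have Ik : I k%:Z%:~R by rewrite -[_%:~R]kE normCK mulrC; apply: IM => //; exact/OK_conj/IOK.
pose H (m n : int) := I (m%:~R + n%:~R * omega).
have [|||g [p [t [_ HP]]]] := @int_subgroup2_basis H k k0.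
- by move=> m n m' n' Hmn /(IB _ _ Hmn); rewrite /H !intrB; congr I; ring.
- by rewrite /H mul0r addr0.
- by rewrite /H add0r mulrC; apply: IM => //; exact: OK_omega.
exists (absz (g * t - 0 * p)%R), g, 0, p, t; split=> //.
apply/seteqP; split=> y; rewrite /mkset /ofZ.
  move=> Iy; have [m [n yE]] := IOK _ Iy; rewrite yE in Iy.
  have [a [b [mE nE]]] := (HP m n).1 Iy.
  by exists a, b; rewrite yE /ofZ mE nE intrD !intrM; ring.
move=> [a [b ->]]; suff : H (a * g + b * p) (b * t).
  by rewrite /H intrD !intrM; congr I; ring.
by apply/HP; exists a, b.
Qed.

Lemma latt_nondegenerate (w1 w2 : C) : w2 * w1^* - w2^* * w1 != 0 ->
  w1 != 0 /\ complex.Im (w2 / w1) != 0.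
Proof.
move=> det0; have w1_neq0 : w1 != 0.
  by apply: contra_neq det0 => ->; rewrite conjC0 !mulr0 subrr.
split=> //; apply: contra_neq det0 => Im0.
have w1c_neq0 : w1^* != 0 by rewrite conjC_eq0.
have : (w2 / w1)^* = w2 / w1.
  by apply: conj_Creal; case: (w2 / w1) Im0 => a b /= ->; rewrite complex_real.
rewrite rmorphM fmorphV => /(canRL (divfK w1c_neq0)) ->.
by rewrite mulrAC divfK// subrr.
Qed.

Lemma ideal_latt_nondegenerate I (w1 w2 : C) : is_ideal I -> I = latt w1 w2 ->
  w1 != 0 /\ complex.Im (w2 / w1) != 0.
Proof.
move=> /is_idealP[_ [_ _ IM] [x Ix x0]] IE; apply: latt_nondegenerate.
have := IM _ _ OK_omega Ix; move: Ix; rewrite IE => -[m [n xE]] [k [l omegaxE]].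
have : sqrtD * (x * x^*) != 0 by rewrite mulf_neq0 ?sqrtD_neq0 ?mulf_neq0 ?conjC_eq0.
apply: contra_neq => det0.
have -> : sqrtD * (x * x^*) = (omega * x) * x^* - (omega * x)^* * x.
  by rewrite -omega_sub_conj [(omega * x)^*]rmorphM /=; ring.
have -> : (omega * x) * x^* - (omega * x)^* * x =
    (m%:~R * l%:~R - k%:~R * n%:~R) * (w2 * w1^* - w2^* * w1).
  by rewrite omegaxE xE /ofZ !rmorphD !rmorphM /= !rmorph_int; ring.
by rewrite det0 mulr0.
Qed.

Lemma ideal_latt I : is_ideal I -> exists w1 w2 : C,
  [/\ I = latt w1 w2, w1 != 0 & complex.Im (w2 / w1) != 0].
Proof.
move=> idI; have [n [p [q [s [t [IE _]]]]]] := ideal_norm_exists idI.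
have [w1_neq0 Im_w] := ideal_latt_nondegenerate idI IE.
by exists (ofZ R p + ofZ R q * omega), (ofZ R s + ofZ R t * omega).
Qed.

Lemma ideal_rel_norm I n : is_ideal I -> ideal_norm I n -> rel_norm I n%:R.
Proof.
move=> idI [p [q [s [t [IE nE]]]]]; set w1 := ofZ R p + _ in IE; set w2 := ofZ R s + _ in IE.
have [w1_neq0 Im_w] := ideal_latt_nondegenerate idI IE.
have mod_w : OKmod (latt w1 w2) by rewrite -[latt _ _]IE; exact: is_ideal_mod.
have [A [B [Cc [rho [_ norm_w _ covol]]]]] := latt_rel_norm w1_neq0 Im_w mod_w.
suff -> : n%:R = rho :> C by rewrite IE.
apply: (mulIf (_ : `|sqrtD| != 0)); first by rewrite normr_eq0 sqrtD_neq0.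
rewrite -covol -nE natr_absz intr_norm -normrM; congr `|_|.
by rewrite intrB !intrM -omega_sub_conj /w1 /w2 /ofZ !rmorphD !rmorphM /= !rmorph_int; ring.
Qed.

Lemma rel_norm_ideal_norm I n : is_ideal I -> rel_norm I n%:R -> ideal_norm I n.
Proof.
move=> idI normI; have [k kI] := ideal_norm_exists idI.
by have /eqP := rel_norm_unique normI (ideal_rel_norm idI kI); rewrite eqr_nat => /eqP ->.
Qed.

Lemma ideal_rel_norm_exists I : is_ideal I -> exists2 n : nat, (0 < n)%N & rel_norm I n%:R.
Proof.
move=> idI; have [n nI] := ideal_norm_exists idI; have normI := ideal_rel_norm idI nI.
by exists n => //; case: normI => _; rewrite ltr0n.
Qed.

Lemma ideal_norm_mem I n : is_ideal I -> rel_norm I n%:R -> I n%:R.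
Proof.
move=> idI [modI _ IIc]; have : pid n%:R n%:R by exact: pid_mem.
by rewrite -IIc idmulC; exact: (idmul_ideal_sub (is_ideal_conjs idI)).
Qed.

Lemma finite_ideal_norm_le I (r : R) : is_ideal I ->
  finite_set [set x | I x /\ `|x| ^+ 2 <= r%:C].
Proof.
move=> idI; have [w1 [w2 [IE w1_neq0 Im_w]]] := ideal_latt idI.
have [c c0 quad] := sqr_le_norm_comb Im_w.
have w1_gt0 : 0 < `|w1| ^+ 2 by rewrite exprn_gt0 ?normr_gt0.
have [K KE] : exists K : R, K%:C = c%:C * (r%:C / `|w1| ^+ 2).
  by exists (c * (r / Normc.normc w1 ^+ 2)); rewrite !rmorphM fmorphV rmorphXn.
pose N := (Num.truncn K).+1; pose comb (p : int * int) := p.1%:~R * w1 + p.2%:~R * w2.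
apply: (@sub_finite_set _ _ (comb @` [set` box N])); last exact/finite_image/finite_fset.
rewrite IE => _ [[m [n ->]] norm_le]; exists (m, n); last by [].
have sqr_mn : (m%:~R ^+ 2 + n%:~R ^+ 2 : R) < N%:R.
  apply: le_lt_trans (truncnS_gt K); rewrite -lecR KE (le_trans (quad _ _))//.
  rewrite ler_pM2l ?ltcR// ler_pdivlMr// -exprMn -normrM.
  by rewrite -!intr_complex mulrDl -mulrA divfK.
suff : (m, n) \in box N by [].
rewrite mem_box.
have absz_le (k : int) : k%:~R ^+ 2 <= m%:~R ^+ 2 + n%:~R ^+ 2 :> R -> (absz k <= N)%N.
  move=> /le_lt_trans/(_ sqr_mn).
  rewrite -real_normK ?num_real// -intr_norm -natr_absz -natrX ltr_nat => /ltnW.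
  by apply: leq_trans; case: (absz k) => // j; rewrite -mulnn leq_pmulr.
by rewrite !absz_le ?lerDl ?lerDr ?sqr_ge0.
Qed.

(* [k] is a value, prime to [N], of the norm form of [conj J], and [M = b (conj J)^-1]
   for an element [b] taking this value. *)
Lemma class_rep_coprime J (N : nat) : (1 < N)%N -> is_ideal J ->
  exists (M : set C) (mu : C) (k : nat),
    [/\ is_ideal M, mu != 0, J = scal mu M, coprime k N & rel_norm M k%:R].
Proof.
move=> N1 idJ; have idJc := is_ideal_conjs idJ.
have [w1 [w2 [JcE w1_neq0 Im_w]]] := ideal_latt idJc.
have mod_w : OKmod (latt w1 w2) by rewrite -JcE; exact: is_ideal_mod.
have [A [B [Cc [rho [prim norm_w norm_form _]]]]] := latt_rel_norm w1_neq0 Im_w mod_w.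
have [m [n coprime_v]] := primitive_form_coprime_value (ltnW N1) prim.
pose b : C := m%:~R * w1 + n%:~R * w2.
have Jcb : conjs J b by rewrite JcE; exists m, n.
have norm_b : `|b| ^+ 2 = rho * (A * m * m + B * m * n + Cc * n * n)%:~R := norm_form m n.
move: (_ + _ + _) coprime_v norm_b => v coprime_v norm_b.
have [_ rho_gt0 _] := norm_w; have rho0 := lt0r_neq0 rho_gt0.
have v0 : v != 0 by apply: contraTneq coprime_v => ->; rewrite /coprime gcd0n gtn_eqF.
have b0 : b != 0 by rewrite -normr_eq0 -sqrf_eq0 norm_b mulf_neq0 ?intr_eq0.
have v_ge0 : 0 <= v by rewrite -(ler0z C) -(pmulr_rge0 _ rho_gt0) -norm_b exprn_ge0.
have norm_Jc : rel_norm (conjs J) rho by rewrite JcE.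
have norm_M : rel_norm (quot_ideal (conjs J) rho b) (absz v)%:R.
  have -> : (absz v)%:R = `|b| ^+ 2 / rho :> C.
    by rewrite natr_absz ger0_norm// norm_b mulrC mulKf.
  exact: rel_norm_quot_ideal.
exists (quot_ideal (conjs J) rho b), (b / rho)^-1, (absz v); split=> //.
- exact: quot_ideal_is_ideal.
- by rewrite invr_eq0 mulf_neq0 ?invr_eq0.
- by rewrite /quot_ideal conjsK scalA mulVf ?scal1// mulf_neq0 ?invr_eq0.
Qed.

Lemma coprime_id_sub I I' J J' : I `<=` I' -> J `<=` J' -> coprime_id I J -> coprime_id I' J'.
Proof. by move=> II' JJ' [x [y [/II' Ix [/JJ' Jy xy1]]]]; exists x, y. Qed.

Lemma coprime_idmul I J K : I `<=` OK -> OKmod K ->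
  coprime_id I K -> coprime_id J K -> coprime_id (idmul I J) K.
Proof.
move=> IOK modK [x [y [Ix [Ky xy1]]]] [x' [y' [Jx' [Ky' xy1']]]].
exists (x * x'), (y + x * y'); split; first exact: idmul_mem.
split; last by rewrite -[RHS]xy1 -[x in RHS]mulr1 -xy1'; ring.
by apply: (OKmodD modK) => //; case: modK => _ _; apply=> //; exact: IOK.
Qed.

Lemma coprime_idmull I J K : is_ideal I -> is_ideal J ->
  coprime_id (idmul I J) K -> coprime_id I K.
Proof.
move=> /is_ideal_mod modI idJ; apply: coprime_id_sub => //.
by rewrite idmulC; exact: idmul_ideal_sub.
Qed.

Lemma coprime_pid_congr K x y : is_ideal K -> K (x - y) ->
  coprime_id (pid y) K -> coprime_id (pid x) K.
Proof.
move=> /is_ideal_mod[_ KB KM] Kxy [_ [k [[t OKt <-] [Kk yk1]]]].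
exists (x * t), (k - t * (x - y)); split; first by exists t.
by split; [exact/KB/KM|rewrite -yk1; ring].
Qed.

Lemma coprime_pidMr K x y : OK x -> coprime_id (pid (x * y)) K -> coprime_id (pid y) K.
Proof.
move=> OKx; apply: coprime_id_sub => // _ [t OKt <-]; exists (x * t); first exact: OKM.
by rewrite mulrCA mulrA.
Qed.

Lemma coprime_pidM K x y : OKmod K -> OK x ->
  coprime_id (pid x) K -> coprime_id (pid y) K -> coprime_id (pid (x * y)) K.
Proof.
move=> modK OKx copx copy; rewrite mulrC -scal_pid -(idmul_pid _ (OKmod_pid _)).
by apply: coprime_idmul => //; exact: (pid_sub OKmod_OK).
Qed.

Lemma prime_to_ideal cf I : is_ideal cf -> is_ideal I -> coprime_id I cf -> prime_to D cf I.
Proof.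
move=> idcf idI cop; split; first by exists 1; split=> //; rewrite -[X in _ X]/(scal 1 I) scal1.
exists I, OK; split=> //; split; first exact: is_ideal_OK.
split=> //; split; last exact/idmul_OK/is_ideal_mod.
by exists 1, 0; split; [exact: OK1|split; [case: (is_ideal_mod idcf)|rewrite addr0]].
Qed.

(** * The discriminant group of a CM lattice *)

Section CMLattice.
Variables (f : nat) (z : C) (A B Cc : int).
Hypotheses (f_gt0 : (0 < f)%N) (Im_z_gt0 : 0 < complex.Im z) (formz : CM_form z A B Cc).
Local Notation b := (latt 1 z).
Local Notation cbar := (@cbar R D f).
Local Notation Om := (Omega f A B Cc z).
Local Notation den := (f * f * absz D)%N.

Let Im_z : complex.Im z != 0. Proof. by case: formz. Qed.
Let mod_b : OKmod b. Proof. by case: formz. Qed.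
Let A_gt0 : 0 < A. Proof. by case: formz. Qed.
Let A_neq0 : (A%:~R : C) != 0. Proof. by rewrite intr_eq0 gt_eqF. Qed.
Let f_neq0 : (f%:R : C) != 0. Proof. by rewrite pnatr_eq0 -lt0n. Qed.
Let den_gt0 : (0 < den)%N. Proof. by rewrite !muln_gt0 f_gt0 absz_gt0 (lt_eqF D_lt0). Qed.
Let den_neq0 (F : numFieldType) : den%:R != 0 :> F. Proof. by rewrite pnatr_eq0 -lt0n. Qed.
Let root_z : A%:~R * z ^+ 2 + B%:~R * z + Cc%:~R = 0. Proof. by case: formz. Qed.

Lemma sqrtD_upper_half : sqrtD = 2 * A%:~R * z + B%:~R.
Proof.
case: (CM_form_sqrtD formz) => // sqrtDE; have := Im_sqrtD_gt0; rewrite sqrtDE !intr_complex.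
have -> : 2 = (2%:R : R)%:C :> C by rewrite rmorph_nat.
case: z Im_z_gt0 => a v /= v_gt0; rewrite !(mul0r, mulr0, addr0, subr0, add0r) oppr_gt0 ltNge.
by rewrite mulr_ge0 ?mulr_ge0 ?ler0z ?ltW.
Qed.

Lemma disc_orderE : disc_order f A B Cc = den.
Proof.
rewrite /disc_order -(CM_form_disc formz) !abszM; congr (_ * _)%N.
by rewrite -abszN; congr absz; ring.
Qed.

Lemma sqrt2Af_neq0 : ofR (Num.sqrt (2%:R * A%:~R * f%:R : R)) != 0.
Proof.
rewrite (fmorph_eq0 (real_complex R)) sqrtr_eq0 -ltNge.
by rewrite !mulr_gt0 ?ltr0z ?ltr0n.
Qed.

Lemma i_sqrt_disc_order : 'i%C * ofR (Num.sqrt (disc_order f A B Cc)%:R) = f%:R * sqrtD.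
Proof.
have absD : (absz D)%:R = - D%:~R :> R by rewrite -mulrNz -[in RHS]ltz0_abs.
rewrite disc_orderE /ofR /Defs.sqrtD natrM sqrtrM ?ler0n// natrM -expr2 sqrtr_sqr.
rewrite ger0_norm// absD.
have -> : f%:R = (f%:R : R)%:C :> C by rewrite rmorph_nat.
by apply/eqP; rewrite eq_complex /= !mul0r !mulr0 !mul1r !subr0 !addr0 ?add0r !eqxx.
Qed.

Lemma OmegaE (y : rat * rat) : Om y = f%:R * sqrtD * (ofQ R y.1 - ofQ R y.2 * z).
Proof. by rewrite /Omega /Omega' -mulrA mulKf ?sqrt2Af_neq0// i_sqrt_disc_order. Qed.

Lemma ofQ_gram (x y : rat * rat) : ofQ R (gram f A B Cc x y) =
  f%:R * (2 * A%:~R * ofQ R x.1 * ofQ R y.1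
          + B%:~R * (ofQ R x.1 * ofQ R y.2 + ofQ R x.2 * ofQ R y.1)
          + 2 * Cc%:~R * ofQ R x.2 * ofQ R y.2).
Proof. by rewrite /ofQ /gram !(rmorphD, rmorphM) /= !ratr_nat !ratr_int !rmorph1. Qed.

Lemma Omega_gram (y : rat * rat) :
  Om y = ofQ R (gram f A B Cc y (0, 1)) + ofQ R (gram f A B Cc y (1, 0)) * z.
Proof.
rewrite OmegaE !ofQ_gram /= /ofQ !rmorph0 !rmorph1 sqrtD_upper_half.
apply/subr0_eq; transitivity (- 2 * f%:R * ratr y.2 * (A%:~R * z ^+ 2 + B%:~R * z + Cc%:~R)).
  by ring.
by rewrite root_z mulr0.
Qed.

Lemma OmegaB (x y : rat * rat) : Om (x.1 - y.1, x.2 - y.2) = Om x - Om y.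
Proof. by rewrite !OmegaE /= /ofQ !rmorphB /=; ring. Qed.

Lemma Omega_inj : injective Om.
Proof.
move=> x y Omxy; have : ofQ R (x.1 - y.1) + ofQ R (- (x.2 - y.2)) * z = 0.
  apply: (mulfI (mulf_neq0 f_neq0 sqrtD_neq0)).
  have := OmegaB x y; rewrite Omxy subrr OmegaE /= => OmB0.
  by rewrite mulr0 -[RHS]OmB0 /ofQ rmorphN mulNr.
move=> /(rat_comb_eq0 Im_z)[/subr0_eq xy1 /eqP]; rewrite oppr_eq0 => /eqP/subr0_eq.
by case: x y xy1 {Omxy} => [? ?] [? ?] /= -> ->.
Qed.

Lemma in_dualP (y : rat * rat) : in_dual f A B Cc y <-> b (Om y).
Proof.
rewrite Omega_gram; split=> [[[k ->] [l ->]]|[m [n]]].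
  by exists l, k; rewrite /ofZ /ofQ !ratr_int mulr1.
rewrite /ofZ mulr1 => mnE; have : ofQ R (gram f A B Cc y (0, 1) - m%:~R) +
    ofQ R (gram f A B Cc y (1, 0) - n%:~R) * z = 0.
  rewrite /ofQ !rmorphB /= !ratr_int mulrBl addrACA -opprD; apply/eqP.
  by rewrite subr_eq0; exact/eqP.
by case/(rat_comb_eq0 Im_z) => /subr0_eq gram1 /subr0_eq gram0; split; [exists n|exists m].
Qed.

Lemma Omega_latP u : (exists l, in_lat l /\ u = Om l) <-> idmul cbar b u.
Proof.
rewrite idmulC idmul_pid//; split.
  move=> [_ [[m [n ->]] ->]]; rewrite OmegaE /ofQ /= !ratr_int.
  by exists (m%:~R - n%:~R * z) => //; exists m, (- n); rewrite /ofZ mulr1 mulrNz mulNr.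
move=> [_ [m [n ->]] <-]; exists (m%:~R, (- n)%:~R); split; first by exists m, (- n).
by rewrite OmegaE /ofQ /= !ratr_int /ofZ mulr1 mulrNz mulNr opprK.
Qed.

(* [Lambda^vee] is contained in [(1 / den) Z^2], over which [f_act] sums. *)
Definition frac (p : int * int) : rat * rat := (p.1%:~R / den%:R, p.2%:~R / den%:R).

Lemma frac_inj : injective frac.
Proof.
move=> [m n] [k l] [mk nl].
have den_inv : den%:R^-1 != 0 :> rat by rewrite invr_eq0 den_neq0.
by rewrite (intr_inj (mulIf den_inv mk)) (intr_inj (mulIf den_inv nl)).
Qed.

Lemma Omega_frac (m n : int) : Om (frac (m, n)) = f%:R * sqrtD / den%:R * (m%:~R - n%:~R * z).
Proof.
rewrite OmegaE /ofQ /frac /= !fmorph_div /= !ratr_int !ratr_nat.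
by move: den%:R (den_neq0 C) => e e0; field.
Qed.

Lemma Omega_frac_surj u : b u -> exists p, Om (frac p) = u.
Proof.
move=> [k [l ->]]; exists (f%:Z * (2 * Cc * l - B * k), f%:Z * (2 * A * k - B * l)).
rewrite Omega_gram !ofQ_gram /frac /= /ofQ !fmorph_div /= !ratr_int !ratr_nat.
rewrite !rmorph0 !rmorph1 /ofZ mulr1 !(intrM, intrB).
have denE : den%:R = f%:R * f%:R * (4 * A%:~R * Cc%:~R - B%:~R * B%:~R) :> C.
  by rewrite !natrM absz_disc -(CM_form_disc formz) intrB !intrM; ring.
have := den_neq0 C; rewrite denE => denE0; field.
by move: denE0; rewrite !mulf_eq0 !negb_or => /andP[/andP[-> _] ->].
Qed.

Lemma Omega_frac_congr (p q : int * int) : idmul cbar b (Om (frac p) - Om (frac q)) <->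
  exists m n : int, p.1 = q.1 + m * den%:Z /\ p.2 = q.2 + n * den%:Z.
Proof.
have den_neq0Q := den_neq0 rat; rewrite -OmegaB; split.
  move=> /Omega_latP[_ [[m [n ->]] /Omega_inj[]]]; rewrite /frac /= -!mulrBl -!rmorphB.
  move=> /(canRL (divfK den_neq0Q)) pq1 /(canRL (divfK den_neq0Q)) pq2; exists m, n.
  by split; apply/eqP; rewrite addrC -subr_eq -(eqr_int rat) ?pq1 ?pq2 intrM.
move=> [m [n [pq1 pq2]]]; apply/Omega_latP; exists (m%:~R, n%:~R); split; first by exists m, n.
congr Om; congr pair; rewrite /frac /= -mulrBl -rmorphB ?pq1 ?pq2 /= addrAC subrr add0r intrM.
  exact: mulfK.
exact: mulfK.
Qed.

Definition kappa : C := ofR (Num.sqrt (2%:R * A%:~R * f%:R)) / (f%:R * sqrtD).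

Lemma kappa_neq0 : kappa != 0.
Proof. by rewrite mulf_neq0 ?sqrt2Af_neq0// invr_eq0 mulf_neq0 ?sqrtD_neq0. Qed.

Lemma Omega'E (y : rat * rat) : Omega' f A z y = kappa * Om y.
Proof. by rewrite OmegaE /Omega' /kappa; field; rewrite f_neq0 sqrtD_neq0. Qed.

Lemma gram_norm (y : rat * rat) :
  f%:R * (absz D)%:R * ofQ R (gram f A B Cc y y) = 2 * A%:~R * `|Om y| ^+ 2.
Proof.
have [trace_z norm_z] := CM_form_conj formz.
have realQ (q : rat) : (ofQ R q)^* = ofQ R q.
  by rewrite conj_Creal// ofQ_complex complex_real.
rewrite OmegaE ofQ_gram normrM normrM !exprMn norm_sqrtD normr_nat.
move: (realQ y.1) (realQ y.2); move: (ofQ R y.1) (ofQ R y.2) => p q pJ qJ.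
have -> : `|p - q * z| ^+ 2 = p * p - p * q * (z + z^*) + q * q * `|z| ^+ 2.
  by rewrite !normCK rmorphB rmorphM /= pJ qJ; ring.
by rewrite trace_z norm_z; field.
Qed.

(** * Theta series of a CM lattice *)

Definition theta_term (tau w : C) : C :=
  kappa * w * cexp (2%:R * ofR pi * 'i * tau * (A%:~R * `|w| ^+ 2)).

Lemma sqr_le_norm_Omega_frac : exists2 c : R, 0 < c & forall p : int * int,
  p.1%:~R ^+ 2 + p.2%:~R ^+ 2 <= c * Normc.normc (Om (frac p)) ^+ 2.
Proof.
have Im_Nz : complex.Im (- z) != 0 by rewrite raddfN oppr_eq0.
have [c c0 quad] := sqr_le_norm_comb Im_Nz.
pose s := Normc.normc (f%:R * sqrtD / den%:R : C).
have s_neq0 : s != 0.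
  apply/eqP => /Normc.eq0_normc/eqP; apply/negP.
  by rewrite !mulf_neq0 ?invr_eq0 ?sqrtD_neq0 ?den_neq0.
have s2_gt0 : 0 < s ^+ 2 by rewrite exprn_even_gt0.
exists (c / s ^+ 2) => [|[m n]]; first exact: divr_gt0.
rewrite Omega_frac Normc.normcM exprMn mulrA divfK ?gt_eqF// -lecR.
have := quad m%:~R n%:~R; rewrite mulrN -!intr_complex.
by rewrite rmorphM rmorphXn.
Qed.

Lemma norm_theta_term (tau w : C) : `|theta_term tau w| = (Normc.normc kappa *
  (Normc.normc w * expR (- (2 * pi * A%:~R * complex.Im tau * Normc.normc w ^+ 2))))%:C.
Proof.
rewrite /theta_term normrM (normrM kappa) norm_cexp -mulrA [RHS]rmorphM [X in _ = _ * X]rmorphM.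
congr (_ * (_ * (expR _)%:C)).
have -> : A%:~R * `|w| ^+ 2 = (A%:~R * Normc.normc w ^+ 2)%:C.
  by rewrite rmorphM rmorphXn intr_complex.
have -> : 2%:R = (2%:R : R)%:C :> C by rewrite rmorph_nat.
by rewrite -complexiE; case: tau => u v /=; ring.
Qed.

Lemma theta_term_summable (P : C -> bool) (tau : C) : 0 < complex.Im tau ->
  exists l, has_sum (fun p => let w := Om (frac p) in if P w then theta_term tau w else 0) l.
Proof.
move=> Im_tau; have [c c0 quad] := sqr_le_norm_Omega_frac.
have k0 : 0 < 2 * pi * A%:~R * complex.Im tau by rewrite !mulr_gt0 ?pi_gt0// ltr0z.
have normc_ge0 (w : C) : 0 <= Normc.normc w by rewrite -ler0c; exact: (normr_ge0 w).
apply: (has_sum_gauss (K := Normc.normc kappa) k0 c0 _ _ quad) => // p /=.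
case: ifP => _; first by rewrite norm_theta_term.
by rewrite normr0 ler0c !mulr_ge0 ?expR_ge0.
Qed.

Lemma f_act_has_sum (g : C) (y0 : rat * rat) (tau : C) : 0 < complex.Im tau ->
  has_sum (fun w => if `[< b w /\ idmul cbar b (g * w - Om y0) >] then theta_term tau w else 0)
    (f_act D f A B Cc z g y0 tau).
Proof.
move=> Im_tau; set F := (X in has_sum X).
have f_actE : f_act D f A B Cc z g y0 tau = Z2sum (fun m n => F (Om (frac (m, n)))).
  rewrite /f_act disc_orderE /=; congr Z2sum; apply/funext => m; apply/funext => n; rewrite /F.
  rewrite -[(_, _)]/(frac (m, n)); set y := frac (m, n).
  have condE : (in_dual f A B Cc y /\ exists l, in_lat l /\ g * Om y = Om y0 + Om l) =
      (b (Om y) /\ idmul cbar b (g * Om y - Om y0)).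
    apply/propext; rewrite -Omega_latP -in_dualP; split=> -[bw [l [lat_l lE]]]; split=> //;
      exists l; split=> //; first by rewrite lE addrAC subrr add0r.
    by rewrite -lE addrC subrK.
  rewrite condE; case: ifP => // _; rewrite /theta_term Omega'E; congr (_ * cexp _).
  have gramE := gram_norm y; rewrite (_ : ofZ R (absz D) = (absz D)%:R)//.
  transitivity (ofR pi * 'i * tau * (f%:R * (absz D)%:R * ofQ R (gram f A B Cc y y))).
    by ring.
  by rewrite gramE; ring.
have [l Fl] := theta_term_summable (fun w => `[< b w /\ idmul cbar b (g * w - Om y0) >]) Im_tau.
have -> : f_act D f A B Cc z g y0 tau = l.
  rewrite f_actE; apply: Z2sum_has_sum.
  by rewrite (_ : (fun p => _) = fun p => F (Om (frac p)))//; apply/funext => -[].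
apply: has_sum_reindex Fl; first exact: inj_comp Omega_inj frac_inj.
move=> w; rewrite /F; case: asboolP => [[bw _] _|]; last by rewrite eqxx.
exact: Omega_frac_surj.
Qed.

Definition unit_reps : seq C :=
  [seq a <- [seq ofZ R (nat_of_ord i)%:Z + ofZ R (nat_of_ord j)%:Z * omega |
               i <- enum 'I_(f * absz D), j <- enum 'I_(f * absz D)] |
   `[< coprime_id (pid a) cbar >]].

Lemma F_genE (chi : C -> C) (y0 : rat * rat) (tau : C) :
  F_gen D f chi A B Cc z y0 tau =
  (absz D)%:R^-1 * \sum_(a <- unit_reps) chi a * f_act D f A B Cc z a y0 tau.
Proof.
rewrite /F_gen big_filter [in RHS]big_mkcond big_allpairs_dep /= big_enum; congr (_ * _).
by apply: eq_bigr => i _; rewrite big_enum.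
Qed.

Lemma unit_repsP a : a \in unit_reps -> OK a /\ coprime_id (pid a) cbar.
Proof.
rewrite mem_filter => /andP[/asboolP cop /allpairsP[[i j] /= [_ _ aE]]]; split=> //.
by rewrite aE; exists (nat_of_ord i)%:Z, (nat_of_ord j)%:Z.
Qed.

Lemma size_unit_reps_gt0 : (0 < size unit_reps)%N.
Proof.
have N1 : (1 < f * absz D)%N by rewrite (leq_trans (fund_disc_gt1 fund_D))// leq_pmull.
rewrite -has_predT; apply/hasP; exists 1 => //; rewrite mem_filter; apply/andP; split.
  apply/asboolP; exists 1, 0; split; first exact: pid_mem.
  by split; [case: (OKmod_pid (f%:R * sqrtD))|rewrite addr0].
apply/allpairsP; exists (Ordinal N1, Ordinal (ltnW N1)); rewrite !mem_enum; split=> //=.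
by rewrite /ofZ mul0r addr0.
Qed.

Definition dual_reps : seq (rat * rat) :=
  [seq y <- [seq frac ((nat_of_ord i)%:Z, (nat_of_ord j)%:Z) |
               i <- enum 'I_den, j <- enum 'I_den] |
   `[< in_dual f A B Cc y >]].

Lemma dual_reps_in_dual (y : rat * rat) : y \in dual_reps -> in_dual f A B Cc y.
Proof. by rewrite mem_filter => /andP[/asboolP]. Qed.

Lemma uniq_dual_reps : uniq dual_reps.
Proof.
rewrite filter_uniq// allpairs_uniq ?enum_uniq// => -[i j] [k l] _ _ /= /frac_inj [ik jl].
by congr pair; apply: val_inj.
Qed.

Lemma is_ideal_cbar : is_ideal cbar.
Proof.
apply/is_idealP; split; last 1 first.
- by exists (f%:R * sqrtD); [exact: pid_mem|rewrite mulf_neq0 ?sqrtD_neq0].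
- by apply: (pid_sub OKmod_OK); apply: OKM OK_sqrtD; exact: (OK_int f).
- exact: OKmod_pid.
Qed.

Lemma dual_reps_exists v : b v -> exists2 y, y \in dual_reps & idmul cbar b (v - Om y).
Proof.
move=> bv; have [[m n] vE] := Omega_frac_surj bv.
have den_pos : 0 < den%:Z by [].
have modE k : (absz (k %% den)%Z)%:Z = (k %% den)%Z by rewrite gez0_abs// modz_ge0 ?gt_eqF.
have ltden k : (absz (k %% den)%Z < den)%N by rewrite -ltz_nat modE ltz_pmod.
pose y := frac ((m %% den)%Z, (n %% den)%Z).
have cong_y : idmul cbar b (v - Om y).
  rewrite -vE; apply/Omega_frac_congr; exists (m %/ den)%Z, (n %/ den)%Z.
  by rewrite /= !(addrC (_ %% _)%Z) -!divz_eq.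
exists y => //; rewrite mem_filter; apply/andP; split.
  apply/asboolP/in_dualP; rewrite -(subKr v (Om y)); have [_ bB _] := mod_b; apply: bB => //.
  exact: (idmul_ideal_sub is_ideal_cbar).
apply/allpairsP; exists (Ordinal (ltden m), Ordinal (ltden n)).
by rewrite !mem_enum /= !modE.
Qed.

Lemma dual_reps_unique v (y y' : rat * rat) : y \in dual_reps -> y' \in dual_reps ->
  idmul cbar b (v - Om y) -> idmul cbar b (v - Om y') -> y = y'.
Proof.
rewrite !mem_filter => /andP[_ /allpairsP[[i j] [_ _ ->]]] /andP[_ /allpairsP[[k l] [_ _ ->]]].
move=> cong_ij cong_kl; have [_ cbB _] : OKmod (idmul cbar b) by exact/OKmod_idmul/OKmod_pid.
have := cbB _ _ cong_kl cong_ij; rewrite opprB addrC addrA subrK => /Omega_frac_congr /=.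
have ord_eq (i1 i2 : 'I_den) (m : int) : i1%:Z = i2%:Z + m * den%:Z -> i1 = i2.
  move=> /(congr1 (modz^~ den%:Z)); rewrite /= addrC modzMDl !modz_small ?ltz_nat ?ltn_ord//.
  by case=> /val_inj.
by move=> [m [n [/ord_eq -> /ord_eq ->]]].
Qed.

Lemma sum_dual_reps (psi : C -> C) (v t : C) : b v ->
  (forall w w', idmul cbar b (w - w') -> psi w = psi w') ->
  \sum_(y <- dual_reps) psi (Om y) * (if `[< idmul cbar b (v - Om y) >] then t else 0) =
  psi v * t.
Proof.
move=> bv psi_per; have [y y_rep cong_y] := dual_reps_exists bv.
rewrite (bigD1_seq y)//=; last exact: uniq_dual_reps.
rewrite asboolT// big_seq_cond big1 ?addr0 ?(psi_per _ _ cong_y)// => y' /andP[y'_rep].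
case: asboolP => [cong_y'|]; last by rewrite mulr0.
by rewrite (dual_reps_unique y_rep y'_rep cong_y cong_y') eqxx.
Qed.

Definition isotypic (chi psi : C -> C) : Prop :=
  [/\ forall w, psi w != 0 -> b w,
      forall w w', idmul cbar b (w - w') -> psi w = psi w' &
      forall g w, OK g -> coprime_id (pid g) cbar -> b w -> chi g * psi (g * w) = psi w].

Lemma sum_isotypic (chi psi : C -> C) (w t : C) : isotypic chi psi -> b w ->
  \sum_(y <- dual_reps) psi (Om y) *
    (\sum_(g <- unit_reps) chi g * (if `[< idmul cbar b (g * w - Om y) >] then t else 0)) =
  (size unit_reps)%:R * (psi w * t).
Proof.
move=> [_ psi_per psi_equiv] bw; under eq_bigr do rewrite mulr_sumr.
rewrite exchange_big /=; transitivity (\sum_(g <- unit_reps) psi w * t); last first.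
  by rewrite big_const_seq count_predT iter_addr_0 mulr_natl.
rewrite big_seq [RHS]big_seq; apply: eq_bigr => g /unit_repsP[OKg cop_g].
under eq_bigr do rewrite mulrCA.
have bgw : b (g * w) by case: mod_b => _ _; exact.
by rewrite -mulr_sumr sum_dual_reps// mulrA psi_equiv.
Qed.

Lemma isotypic_theta_in_span (chi psi : C -> C) : isotypic chi psi ->
  exists s : seq ((rat * rat) * C),
    (forall e, e \in s -> in_dual f A B Cc e.1) /\
    forall tau, 0 < complex.Im tau ->
      has_sum (fun w => psi w * theta_term tau w)
        (\sum_(e <- s) e.2 * F_gen D f chi A B Cc z e.1 tau).
Proof.
move=> iso; pose k : C := (absz D)%:R / (size unit_reps)%:R.
exists [seq (e, k * psi (Om e)) | e <- dual_reps]; split.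
  by move=> _ /mapP[e e_rep ->]; exact: dual_reps_in_dual.
move=> tau Im_tau; rewrite big_map /=.
pose term g e w : C :=
  if `[< b w /\ idmul cbar b (g * w - Om e) >] then theta_term tau w else 0.
have -> : (fun w => psi w * theta_term tau w) = fun w => \sum_(e <- dual_reps)
    k * psi (Om e) * ((absz D)%:R^-1 * \sum_(g <- unit_reps) chi g * term g e w).
  apply/funext => w; have [bw|nbw] := pselect (b w); last first.
    have -> : psi w = 0 by apply: contra_notP nbw => /eqP; case: iso => + _ _; exact.
    rewrite mul0r big1// => e _; rewrite big1 ?mulr0// => g _.
    by rewrite /term asboolF ?mulr0// => -[].
  transitivity (k / (absz D)%:R * ((size unit_reps)%:R * (psi w * theta_term tau w))).
    rewrite /k; field.
    by rewrite pnatr_eq0 absz_eq0 (lt_eqF D_lt0) pnatr_eq0 -lt0n size_unit_reps_gt0.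
  rewrite -(sum_isotypic _ iso bw) mulr_sumr; apply: eq_bigr => e _.
  rewrite mulrACA; congr (_ * (_ * _)).
  apply: eq_bigr => g _; congr (_ * _); rewrite /term.
  have [cong_e|ncong_e] := pselect (idmul cbar b (g * w - Om e)); first by rewrite !asboolT.
  by rewrite !asboolF// => -[].
apply: has_sum_sum => e _; apply: has_sumZ; rewrite F_genE; apply: has_sumZ.
by apply: has_sum_sum => g _; apply: has_sumZ; exact: f_act_has_sum.
Qed.

End CMLattice.

(** * Sums over ideals as sums over class representatives *)

Definition ideals_of_norm (n : nat) : set (set C) := [set J | is_ideal J /\ ideal_norm J n].

Definition unitsOK : set C := [set u | pid u = OK].

Definition num_units : C := \sum_(u \in unitsOK) (1 : C).

Lemma unitsOK_neq0 u : unitsOK u -> u != 0.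
Proof.
move=> pidu; apply: contraTneq (oner_neq0 C) => u0; rewrite negbK.
by have := OK1; rewrite -[OK]pidu u0 => -[y _]; rewrite mul0r => <-.
Qed.

Lemma finite_unitsOK : finite_set unitsOK.
Proof.
apply: sub_finite_set (finite_ideal_norm_le 1 is_ideal_OK) => u pidu.
split; first by rewrite -[OK]pidu; exact: pid_mem.
have : pid u = pid 1 by rewrite pidu [pid 1]scal1.
by move=> /(pid_eq_norm (unitsOK_neq0 pidu)) ->; rewrite normr1 expr1n.
Qed.

Lemma num_units_neq0 : num_units != 0.
Proof.
rewrite /num_units fsbig_finite; last exact: finite_unitsOK.
rewrite big_const_seq count_predT iter_addr_0 pnatr_eq0 -lt0n -has_predT.
apply/hasP; exists 1 => //; rewrite in_fset_set; last exact: finite_unitsOK.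
by rewrite inE; exact: scal1.
Qed.

Section IdealClasses.
Variables (I : finType) (M : I -> set C) (m : I -> C).
Hypotheses (idM : forall a, is_ideal (M a)) (normM : forall a, rel_norm (M a) (m a)).

Definition ideal_of (y : I * C) : set C := quot_ideal (M y.1) (m y.1) y.2.

Definition norm_fibre (n : nat) : set (I * C) :=
  [set y | [/\ M y.1 y.2, y.2 != 0 & `|y.2| ^+ 2 = n%:R * m y.1]].

Hypotheses
  (class_cover : forall J, is_ideal J -> exists a x, [/\ M a x, x != 0 & J = ideal_of (a, x)])
  (class_sep : forall a a' x x', M a x -> x != 0 -> x' != 0 ->
     ideal_of (a, x) = ideal_of (a', x') -> a = a').

Let m_gt0 a : 0 < m a. Proof. by case: (normM a). Qed.
Let m_neq0 a : m a != 0. Proof. exact: lt0r_neq0. Qed.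

Lemma norm_fibreP (n : nat) a x : M a x -> x != 0 ->
  norm_fibre n (a, x) <-> ideal_norm (ideal_of (a, x)) n.
Proof.
move=> Max x0; have idJ := quot_ideal_is_ideal (normM a) Max x0.
have normJ := rel_norm_quot_ideal (normM a) x0; split=> [[_ _ /= xn]|nJ].
  by apply: rel_norm_ideal_norm => //; move: normJ; rewrite xn mulfK.
split=> //=; have := rel_norm_unique (ideal_rel_norm idJ nJ) normJ => ->.
by rewrite divfK.
Qed.

Lemma ideal_of_norm_fibre n : ideal_of @` norm_fibre n = ideals_of_norm n.
Proof.
apply/seteqP; split=> [_ [[a x] fibx <-]|J [idJ nJ]].
  have [/= Max x0 _] := fibx; split; last exact/norm_fibreP.
  exact: quot_ideal_is_ideal (normM a) Max x0.
have [a [x [Max x0 JE]]] := class_cover idJ; exists (a, x) => //.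
by apply/norm_fibreP; rewrite -?JE.
Qed.

Lemma finite_norm_fibre n : finite_set (norm_fibre n).
Proof.
pose r a := complex.Re (n%:R * m a).
have rE a : (r a)%:C = n%:R * m a by rewrite RRe_real// realM ?realn// gtr0_real.
pose disk a := [set x | M a x /\ `|x| ^+ 2 <= (r a)%:C].
apply: (@sub_finite_set _ _ (\bigcup_(a in [set: I]) pair a @` disk a)).
  by move=> [a x] [/= Max _ xn]; exists a => //; exists x => //; split=> //; rewrite rE xn.
by apply: bigcup_finite => // a _; exact/finite_image/finite_ideal_norm_le.
Qed.

Lemma norm_fibre_torsor n J : ideals_of_norm n J -> exists2 x1 : C, x1 != 0 &
  set_bij (norm_fibre n `&` ideal_of @^-1` [set J]) unitsOK (fun p => p.2 / x1).
Proof.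
move=> [idJ nJ]; have [a [x1 [Max1 x1_neq0 JE]]] := class_cover idJ.
have modJ := is_ideal_mod idJ.
have JM : idmul J (M a) = pid x1 by apply/(quot_idealP _ (normM a) modJ).
have fst_eq p : (norm_fibre n `&` ideal_of @^-1` [set J]) p -> p.1 = a.
  by case: p => a' y [[/= May y0 _] idy]; apply: (class_sep May y0 x1_neq0); rewrite -JE.
exists x1 => //; split.
- move=> p fibJp; have p1 := fst_eq _ fibJp; case: p fibJp p1 => a' y [[/= May y0 _] idy] a'E.
  have JMy : idmul J (M a) = pid y by apply/(quot_idealP _ (normM a) modJ); rewrite -idy a'E.
  by rewrite /unitsOK /= mulrC -scal_pid -JMy JM scalA mulVf// scal1.
- move=> [a1 y1] [a2 y2]; rewrite !inE => /fst_eq/= -> /fst_eq/= ->.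
  by move=> /(mulIf (invr_neq0 x1_neq0)) ->.
- move=> u unitu; have u0 := unitsOK_neq0 unitu.
  have OKu : OK u by rewrite -[OK]unitu; exact: pid_mem.
  have Mux : M a (u * x1) by have [_ _ MM] := is_ideal_mod (idM a); exact: MM.
  have idux : ideal_of (a, u * x1) = J.
    by apply/esym/(quot_idealP _ (normM a) modJ); rewrite JM mulrC -scal_pid unitu.
  exists (a, u * x1); last by rewrite /= mulfK.
  split=> //; apply/norm_fibreP => //; last by rewrite idux.
  by rewrite mulf_neq0.
Qed.

Lemma sum_ideals_of_norm (c : set C -> C) n :
  num_units * (\sum_(J \in ideals_of_norm n) c J) = \sum_(p \in norm_fibre n) c (ideal_of p).
Proof.
rewrite (partition_fsbig ideal_of _ (finite_norm_fibre n)) ideal_of_norm_fibre mulr_fsumr.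
apply: eq_fsbigr => J; rewrite inE => nJ; have [x1 _ torsor] := norm_fibre_torsor nJ.
rewrite /num_units (reindex_fsbig _ _ _ (fun=> 1) torsor) mulr_fsuml.
by apply: eq_fsbigr => p; rewrite inE mul1r => -[_ /= ->].
Qed.

Definition norm_fibres_below (n : nat) : set (I * C) := \bigcup_(k in `I_n) norm_fibre k.

Lemma norm_fibre_inj k n p : norm_fibre k p -> norm_fibre n p -> k = n.
Proof.
move=> [_ _ pk] [_ _]; rewrite pk => /(mulIf (m_neq0 p.1))/eqP.
by rewrite eqr_nat => /eqP.
Qed.

Lemma finite_norm_fibres_below n : finite_set (norm_fibres_below n).
Proof. by apply: bigcup_finite => // k _; exact: finite_norm_fibre. Qed.

Lemma sum_norm_fibres_below (F : I * C -> C) n :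
  \sum_(0 <= k < n) \sum_(p \in norm_fibre k) F p = \sum_(p \in norm_fibres_below n) F p.
Proof.
elim: n => [|n ih]; first by rewrite big_nil /norm_fibres_below II0 bigcup_set0 fsbig_set0.
rewrite big_nat_recr//= ih /norm_fibres_below IIS bigcup_setU bigcup_set1 fsbigU0//.
- exact: finite_norm_fibres_below.
- exact: finite_norm_fibre.
- by move=> p [[k /= kn fibk] /(norm_fibre_inj fibk) nk]; rewrite nk ltnn in kn.
Qed.

Lemma ideal_series_cvg (c : set C -> C) (g : nat -> C) (F : I -> C -> C) (l : I -> C) :
  (forall a x, F a x != 0 -> M a x /\ x != 0) ->
  (forall a x k, norm_fibre k (a, x) -> F a x = c (ideal_of (a, x)) * g k) ->
  (forall a, has_sum (F a) (l a)) ->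
  series (fun k => (\sum_(J \in ideals_of_norm k) c J) * g k : Cnf R) @ \oo -->
    (num_units^-1 * \sum_a l a : Cnf R).
Proof.
move=> F_supp F_fibre Fl.
have -> : series (fun k => (\sum_(J \in ideals_of_norm k) c J) * g k : Cnf R) =
    fun n => num_units^-1 * \sum_(p <- fset_set (norm_fibres_below n)) F p.1 p.2.
  apply/funext => n; apply: (mulfI num_units_neq0); rewrite mulVKf ?num_units_neq0//.
  rewrite -fsbig_finite; last exact: finite_norm_fibres_below.
  rewrite -sum_norm_fibres_below /series /= mulr_sumr; apply: eq_bigr => k _.
  rewrite mulrA sum_ideals_of_norm mulr_fsuml.
  by apply: eq_fsbigr => -[a x]; rewrite inE => /F_fibre.
apply: cvgMl_tmp; apply: has_sum_cvg (has_sum_pair Fl) _ => -[a x] /F_supp[/= Max x0].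
have idJ := quot_ideal_is_ideal (normM a) Max x0.
have [k kJ] := ideal_norm_exists idJ; exists k.+1 => // n /= kn.
rewrite in_fset_set ?inE; last exact: finite_norm_fibres_below.
by exists k => //; exact/norm_fibreP.
Qed.

End IdealClasses.

(** * Oldforms in the span *)

Section LatticeCharacter.
Variables (f : nat) (z : C) (q cf M : set C) (mu : C) (chi chi' : C -> C).
Local Notation b := (latt 1 z).
Local Notation cbar := (@cbar R D f).
Hypotheses (mod_b : OKmod b) (idq : is_ideal q) (idcf : is_ideal cf) (idM : is_ideal M).
Hypotheses (mu_neq0 : mu != 0) (qb_muM : idmul q b = scal mu M).
Hypotheses (cbar_qcf : cbar `<=` idmul q cf) (cbar_cf : cbar `<=` cf).
Hypotheses (chi'_char : residue_char D cf chi') (chi_char : residue_char D cbar chi).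
Hypothesis chi'_pullback : forall g, OK g -> coprime_id (pid g) cbar -> chi' g = (chi g)^-1.

Definition lattice_char (w : C) : C :=
  if `[< M (w / mu) /\ coprime_id (pid (w / mu)) cf >] then chi' (w / mu) else 0.

Let modM : OKmod M. Proof. exact: is_ideal_mod. Qed.
Let modcf : OKmod cf. Proof. exact: is_ideal_mod. Qed.

Lemma muM_sub_b x : M x -> b (mu * x).
Proof. by move=> Mx; apply: (idmul_ideal_sub idq mod_b); rewrite qb_muM; exists x. Qed.

Lemma cbar_b_div_mu v : idmul cbar b v -> cf (v / mu) /\ M (v / mu).
Proof.
move=> cbv; have : scal mu (idmul cf M) v.
  by rewrite -idmul_scalr -qb_muM idmulA (idmulC cf); move: v cbv; exact: idmul_subset.
move=> /(scalP _ _ mu_neq0) cfMv; split; last exact: (idmul_ideal_sub idcf modM).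
by apply: (idmul_ideal_sub idM modcf); rewrite idmulC.
Qed.

Lemma lattice_char_supp w : lattice_char w != 0 -> b w.
Proof.
rewrite /lattice_char; case: asboolP => [[/muM_sub_b + _] _|]; last by rewrite eqxx.
by rewrite mulrC divfK.
Qed.

Lemma lattice_char_periodic w w' : idmul cbar b (w - w') -> lattice_char w = lattice_char w'.
Proof.
move=> /cbar_b_div_mu; rewrite mulrBl /lattice_char.
move: (w / mu) (w' / mu) => x x' [cfxx' Mxx'].
have transfer y y' : cf (y - y') -> M (y - y') -> M y' /\ coprime_id (pid y') cf ->
    M y /\ coprime_id (pid y) cf.
  move=> cfyy' Myy' [My' copy']; split; last exact: coprime_pid_congr cfyy' copy'.
  by rewrite -(subrK y' y); exact: OKmodD.
have [cfx'x Mx'x] : cf (x' - x) /\ M (x' - x) by rewrite -opprB; split; exact: OKmodN.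
case: asboolP => x_supp; case: asboolP => x'_supp //.
- case: x_supp x'_supp => [Mx copx] [Mx' copx'].
  case: chi'_char => chi'_mod _; apply: chi'_mod => //.
    exact: is_ideal_sub Mx.
  exact: is_ideal_sub Mx'.
- by case: x'_supp; exact: transfer x_supp.
- by case: x_supp; exact: transfer x'_supp.
Qed.

Lemma lattice_char_equivariant g w : OK g -> coprime_id (pid g) cbar -> b w ->
  chi g * lattice_char (g * w) = lattice_char w.
Proof.
move=> OKg copg bw; have copg_cf : coprime_id (pid g) cf by exact: coprime_id_sub copg.
have chi_neq0 : chi g != 0 by case: chi_char => _ [_]; exact.
rewrite /lattice_char -mulrA; set x := w / mu.
have supp_iff : M (g * x) /\ coprime_id (pid (g * x)) cf <-> M x /\ coprime_id (pid x) cf.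
  split=> -[Mgx copgx]; split.
  - have [_ [y [[t OKt <-] [cy ty1]]]] := copg.
    have -> : x = t * (g * x) + y * x by rewrite -[LHS]mul1r -ty1; ring.
    apply: OKmodD => //; first by case: modM => _ _; exact.
    by have [_] := cbar_b_div_mu (idmul_mem cy bw); rewrite -mulrA.
  - exact: coprime_pidMr copgx.
  - by case: modM => _ _; exact.
  - exact: coprime_pidM.
case: asboolP => [/supp_iff [Mx copx]|ngx]; last first.
  by rewrite mulr0 asboolF// => /supp_iff.
rewrite asboolT//; case: chi'_char => _ [chi'M _].
have OKx : OK x by exact: (is_ideal_sub idM).
by rewrite chi'M// chi'_pullback// mulrA divff// mul1r.
Qed.

Lemma isotypic_lattice_char : isotypic f z chi lattice_char.
Proof.
split; [exact: lattice_char_supp|exact: lattice_char_periodic|exact: lattice_char_equivariant].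
Qed.

End LatticeCharacter.

Lemma is_ideal_scal_CM z (A B Cc : int) : CM_form z A B Cc -> is_ideal (scal A%:~R (latt 1 z)).
Proof.
move=> formz; have [_ mod_b _ A0 _] := formz; have [_ _ bbc] := rel_norm_CM_form formz.
have A_neq0 : (A%:~R : C) != 0 by rewrite intr_eq0 gt_eqF.
apply/is_idealP; split.
- move=> _ [x bx <-]; have : pid (A%:~R)^-1 (x * 1).
    by rewrite -bbc; apply: idmul_mem => //; apply/conjsP; rewrite conjC1; exact: latt_l.
  by move=> /(scalP _ _ (invr_neq0 A_neq0)); rewrite invrK mulr1 mulrC.
- exact: OKmod_scal.
- by exists (A%:~R * 1); [exists 1 => //; exact: latt_l|rewrite mulr1].
Qed.

Lemma coprime_class_rep z (A B Cc : int) (q cf : set C) (r N : nat) :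
  CM_form z A B Cc -> is_ideal q -> rel_norm q r%:R -> is_ideal cf -> cf N%:R -> (1 < N)%N ->
  exists (M : set C) (mu m : C), [/\ is_ideal M, coprime_id M cf, mu != 0,
    idmul q (latt 1 z) = scal mu M & rel_norm M m /\ r%:R = A%:~R * `|mu| ^+ 2 * m].
Proof.
move=> formz idq normq idcf cfN N1; have [_ _ _ A0 _] := formz.
have A_neq0 : (A%:~R : C) != 0 by rewrite intr_eq0 gt_eqF.
have [M [nu [k [idM nu0 qAbE copkN normM]]]] :=
  class_rep_coprime N1 (is_ideal_idmul idq (is_ideal_scal_CM formz)).
have qbE : idmul q (latt 1 z) = scal (nu / A%:~R) M.
  by apply: (scal_inj A_neq0); rewrite -idmul_scalr qAbE scalA mulrC divfK.
have mu0 : nu / A%:~R != 0 by rewrite mulf_neq0 ?invr_eq0.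
exists M, (nu / A%:~R), k%:R; split=> //.
  have gcd1 : gcdz k N = 1 by rewrite /gcdz /= (eqP copkN).
  have [u [v uvE]] := Bezoutz k N; exists (u%:~R * k%:R), (v%:~R * N%:R).
  split; first exact: OKmodMz (is_ideal_mod idM) (ideal_norm_mem idM normM).
  split; first exact: OKmodMz (is_ideal_mod idcf) cfN.
  by rewrite -[RHS]/(1%:~R) -gcd1 -uvE intrD !intrM.
split=> //; have norm_qb := rel_norm_idmul normq (rel_norm_CM_form formz).
rewrite qbE in norm_qb; have := rel_norm_unique norm_qb (rel_norm_scal mu0 normM) => normE.
by rewrite -mulrA -normE mulrCA divff// mulr1.
Qed.

Lemma level_mem_cbar (f : nat) : cbar D f ((f * absz D)%:R : C).
Proof.
exists (- sqrtD); first by rewrite -[- _]sub0r; exact/OKB/OK_sqrtD/OK0.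
by rewrite mulrN -mulrA sqrtD_sqr natrM absz_disc mulrN.
Qed.

Section Oldform.
Variables (f : nat) (I : finType) (z : I -> C) (A B Cc : I -> int).
Local Notation b a := (latt 1 (z a)).
Local Notation cbar := (@cbar R D f).
Hypotheses (f_gt0 : (0 < f)%N) (Im_z_gt0 : forall a, 0 < complex.Im (z a)).
Hypothesis form_z : forall a, CM_form (z a) (A a) (B a) (Cc a).
Hypothesis z_distinct : forall a a', a != a' -> ~ homothetic (b a) (b a').
Hypothesis z_complete : forall w1 w2 : C, w1 != 0 -> complex.Im (w2 / w1) != 0 ->
  latt_End (latt w1 w2) = OK -> exists a, homothetic (latt w1 w2) (b a).
Variables (chi chi' : C -> C) (phi : set C -> C) (cf : set C).
Hypotheses (chi_char : residue_char D cbar chi) (phi_hecke : hecke_char D cf phi chi').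
Hypotheses (cbar_cf : cbar `<=` cf)
  (chi'_pullback : forall g, OK g -> coprime_id (pid g) cbar -> chi' g = (chi g)^-1).
Variables (r : nat) (q : set C).
Hypotheses (r_gt0 : (0 < r)%N) (idq : is_ideal q) (normq : rel_norm q r%:R)
  (cbar_qcf : cbar `<=` idmul q cf).
Variables (M : I -> set C) (mu m : I -> C).
Hypotheses (idM : forall a, is_ideal (M a)) (copM : forall a, coprime_id (M a) cf)
  (mu_neq0 : forall a, mu a != 0) (qb_muM : forall a, idmul q (b a) = scal (mu a) (M a))
  (normM : forall a, rel_norm (M a) (m a))
  (rE : forall a, r%:R = (A a)%:~R * `|mu a| ^+ 2 * m a).

Let idcf : is_ideal cf. Proof. by case: phi_hecke. Qed.
Let mod_b a : OKmod (b a). Proof. by case: (form_z a). Qed.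
Let m_neq0 a : m a != 0. Proof. by case: (normM a) => _ /lt0r_neq0. Qed.

(* [conj (J q)] is homothetic to some [b a], so [J q (b a)] is principal. *)
Lemma ideal_class_cover J : is_ideal J ->
  exists a x, [/\ M a x, x != 0 & J = ideal_of M m (a, x)].
Proof.
move=> idJ; have [n n_gt0 norm_Jq] := ideal_rel_norm_exists (is_ideal_idmul idJ idq).
have [w1 [w2 [JqcE w1_neq0 Im_w]]] := ideal_latt (is_ideal_conjs (is_ideal_idmul idJ idq)).
have End_w : latt_End (latt w1 w2) = OK.
  by rewrite -JqcE; exact: latt_End_rel_norm (rel_norm_conjs norm_Jq).
have [a [l [l_neq0 bE]]] := z_complete w1_neq0 Im_w End_w.
have JM : idmul J (M a) = pid (l * n%:R / mu a).
  apply: (scal_inj (mu_neq0 a)); rewrite -idmul_scalr -qb_muM idmulA bE -JqcE.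
  have [_ _ normE] := norm_Jq.
  by rewrite -[[set _ | _ in _]]/(scal l _) idmul_scalr normE !scal_pid [mu a * _]mulrC divfK.
exists a, (l * n%:R / mu a); split.
- by apply: (idmul_ideal_sub idJ (is_ideal_mod (idM a))); rewrite JM; exact: pid_mem.
- by rewrite !mulf_neq0 ?invr_eq0// pnatr_eq0 -lt0n.
- exact/(quot_idealP _ (normM a) (is_ideal_mod idJ)).
Qed.

Lemma ideal_class_sep a a' x x' : M a x -> x != 0 -> x' != 0 ->
  ideal_of M m (a, x) = ideal_of M m (a', x') -> a = a'.
Proof.
move=> Max x0 x'0 idxx'; apply/eqP; apply: contraT => /z_distinct[].
pose t := ((x / m a) / (x' / m a'))^*.
have t0 : t != 0 by rewrite conjC_eq0 !mulf_neq0 ?invr_eq0 ?mulf_neq0 ?invr_eq0.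
have x'm0 : x' / m a' != 0 by rewrite mulf_neq0 ?invr_eq0.
have MaE : M a' = scal t (M a).
  rewrite -[LHS]conjsK -[M a]conjsK -conjs_scal; congr conjs; apply: (scal_inj x'm0).
  by rewrite scalA mulrCA divff// mulr1; exact/esym.
exists (mu a' * t / mu a); split; first by rewrite !mulf_neq0 ?invr_eq0.
have r_neq0 : r%:R != 0 :> C by rewrite pnatr_eq0 -lt0n.
have qcqbK k := idmul_conjsK normq (mod_b k).
apply: (scal_inj r_neq0); rewrite -[[set _ | _ in _]]/(scal _ (b a)) scalA mulrC -scalA -!qcqbK.
by rewrite !qb_muM MaE !idmul_scalr !scalA divfK.
Qed.

Definition phi0 (J : set C) : C := if `[< coprime_id J cf >] then phi J else 0.

Lemma phi_M_neq0 a : phi (M a) != 0.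
Proof.
by case: phi_hecke => _ [_ [_ [phi_neq0 _]]]; apply: phi_neq0; exact: prime_to_ideal.
Qed.

Local Notation psi a := (lattice_char cf (M a) (mu a) chi').

Lemma phi0_ideal_of a x : M a x -> x != 0 ->
  phi0 (ideal_of M m (a, x)) = (phi (M a))^-1 * x * psi a (mu a * x).
Proof.
move=> Max x0; have idJ := quot_ideal_is_ideal (normM a) Max x0.
have JM := (quot_idealP x (normM a) (is_ideal_mod idJ)).2 erefl.
rewrite /phi0 /lattice_char [mu a * x]mulrC mulfK// -JM.
case: asboolP => copJ; last first.
  by rewrite asboolF ?mulr0// => -[_ /(coprime_idmull idJ (idM a))].
rewrite asboolT; last first.
  by split=> //; exact: coprime_idmul (is_ideal_sub idJ) (is_ideal_mod idcf) copJ (copM a).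
case: phi_hecke => _ [_ [phiM [_ [phi_pid _]]]].
have OKx : OK x by exact: (is_ideal_sub (idM a)).
have cop_x : coprime_id (pid x) cf.
  by rewrite -JM; exact: coprime_idmul (is_ideal_sub idJ) (is_ideal_mod idcf) copJ (copM a).
rewrite -mulrA -phi_pid// -JM phiM; first by rewrite mulrC mulfK ?phi_M_neq0.
- exact: prime_to_ideal.
- exact: prime_to_ideal.
Qed.

Definition theta_scale a : C := (phi (M a) * kappa f (A a) * mu a)^-1.

Lemma norm_fibre_theta_term tau a x k : norm_fibre M m k (a, x) ->
  theta_scale a * (psi a (mu a * x) * theta_term f (A a) tau (mu a * x)) =
  phi0 (ideal_of M m (a, x)) * cexp (2%:R * ofR pi * 'i * (r%:R * tau) * k%:R).
Proof.
move=> [/= Max x0 xk]; rewrite phi0_ideal_of// /theta_term normrM exprMn xk.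
have -> : 2%:R * ofR pi * 'i * tau * ((A a)%:~R * (`|mu a| ^+ 2 * (k%:R * m a))) =
    2%:R * ofR pi * 'i * (r%:R * tau) * k%:R by rewrite (rE a); ring.
have kappa0 : kappa f (A a) != 0 by exact: kappa_neq0 f_gt0 (form_z a).
rewrite /theta_scale; field.
by rewrite phi_M_neq0 kappa0 mu_neq0.
Qed.

Lemma theta_oldformE tau (l : I -> C) :
  (forall a, has_sum (fun w => psi a w * theta_term f (A a) tau w) (l a)) ->
  theta D cf phi (r%:R * tau) = num_units^-1 * \sum_a theta_scale a * l a.
Proof.
move=> psi_l; apply: cvg_Cnf_lim.
pose F a x := theta_scale a * (psi a (mu a * x) * theta_term f (A a) tau (mu a * x)).
apply: (ideal_series_cvg idM normM ideal_class_cover ideal_class_sep (F := F)).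
- move=> a x; rewrite /F => F0; have x0 : x != 0.
    by apply: contra_neq F0 => ->; rewrite /theta_term !(mulr0, mul0r).
  split=> //; apply: contra_neqP F0 => nMx.
  by rewrite /lattice_char [mu a * x]mulrC mulfK// asboolF ?mul0r ?mulr0// => -[].
- by move=> a x k; exact: norm_fibre_theta_term.
- move=> a; apply: has_sumZ; apply: (has_sum_reindex (j := fun w => w / mu a)).
  + by apply: mulIf; rewrite invr_eq0.
  + by move=> x _; exists (mu a * x); rewrite mulrC mulKf.
  + by rewrite (_ : _ \o _ = fun w => psi a w * theta_term f (A a) tau w)//;
      apply/funext => w /=; rewrite [mu a * _]mulrC divfK.
Qed.

Lemma oldform_in_span : exists s : seq (I * (rat * rat) * C),
  (forall e, e \in s -> in_dual f (A e.1.1) (B e.1.1) (Cc e.1.1) e.1.2) /\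
  forall tau, 0 < complex.Im tau -> r%:R * theta D cf phi (r%:R * tau) =
    \sum_(e <- s) e.2 * F_gen D f chi (A e.1.1) (B e.1.1) (Cc e.1.1) (z e.1.1) e.1.2 tau.
Proof.
have psi_iso a : isotypic f (z a) chi (psi a).
  apply: (isotypic_lattice_char (q := q)) => //.
  by case: phi_hecke => _ [].
have /choice[s sP] a := isotypic_theta_in_span f_gt0 (Im_z_gt0 a) (form_z a) (psi_iso a).
exists [seq (p.1, p.2.1, r%:R / num_units * theta_scale p.1 * p.2.2) |
  p <- [seq (a, e) | a <- enum I, e <- s a]]; split.
  move=> _ /mapP[_ /allpairsPdep[a [e [_ es ->]]] ->] /=.
  by case: (sP a) => + _; exact.
move=> tau Im_tau; rewrite (theta_oldformE (fun a => (sP a).2 _ Im_tau)).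
rewrite big_map big_allpairs_dep /= big_enum mulrA mulr_sumr; apply: eq_bigr => a _.
by rewrite mulrA mulr_sumr; apply: eq_bigr => e _; rewrite !mulrA.
Qed.

End Oldform.

End ImaginaryQuadraticField.

Theorem theorem3p3p12
  (R : realType) (D : int) (hD : neg_fund_disc D)
  (f : nat) (hf : (0 < f)%N)
  (* z_1, ..., z_h : representatives of the C-isomorphism classes of
     elliptic curves with CM by O_K, i.e. of lattices with End = O_K *)
  (h : nat) (z : 'I_h -> R[i])
  (hzH : forall a, 0 < complex.Im (z a))
  (hzCM : forall a, latt_End (latt 1 (z a)) = OK D)
  (hzdist : forall a b, a != b -> ~ homothetic (latt 1 (z a)) (latt 1 (z b)))
  (hzall : forall w1 w2 : R[i], w1 != 0 -> complex.Im (w2 / w1) != 0 ->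
             latt_End (latt w1 w2) = OK D ->
             exists a, homothetic (latt w1 w2) (latt 1 (z a)))
  (* (a_z, b_z, c_z) *)
  (A B Cc : 'I_h -> int)
  (hABC : forall a, [/\ gcdz (gcdz (A a) (B a)) (Cc a) = 1, 0 < A a &
            ofZ R (A a) * z a ^+ 2 + ofZ R (B a) * z a + ofZ R (Cc a) = 0])
  (* chi : character of (O_K / c)^x with chi(u) = u on units *)
  (chi : R[i] -> R[i])
  (hchi : residue_char D (cbar D f) chi)
  (hchiu : forall u, OK D u -> u != 0 -> OK D u^-1 -> chi u = u)
  (* phi : Hecke character of infinity type [-1/2;1,0], conductor cf | c *)
  (phi : set R[i] -> R[i]) (cf : set R[i]) (chi' : R[i] -> R[i])
  (hphi : hecke_char D cf phi chi')
  (hcf : cbar D f `<=` cf)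
  (hpull : forall a, OK D a -> coprime_id (pid D a) (cbar D f) ->
             chi' a = (chi a)^-1)
  (r : nat) (hr : (0 < r)%N)
  (hq : exists q, [/\ is_ideal D q, ideal_norm D q r & cbar D f `<=` idmul q cf]) :
  exists s : seq ('I_h * (rat * rat) * R[i]),
    (forall e, e \in s -> in_dual f (A e.1.1) (B e.1.1) (Cc e.1.1) e.1.2) /\
    forall tau : R[i], 0 < complex.Im tau ->
      r%:R * theta D cf phi (r%:R * tau) =
      \sum_(e <- s) e.2 * F_gen D f chi (A e.1.1) (B e.1.1) (Cc e.1.1) (z e.1.1) e.1.2 tau.
Proof.
have [q [idq norm_q cbar_qcf]] := hq.
have normq := ideal_rel_norm hD idq norm_q.
have form_z a : CM_form D (z a) (A a) (B a) (Cc a).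
  have [prim A0 root] := hABC a; split=> //; first by rewrite gt_eqF.
  split; [exact: latt0|exact: lattB|by rewrite -(hzCM a) => g x; exact].
have cf_level : cf (f * absz D)%:R by apply: hcf; exact: level_mem_cbar.
have level_gt1 : (1 < f * absz D)%N by rewrite (leq_trans (fund_disc_gt1 hD))// leq_pmull.
have idcf : is_ideal D cf by case: hphi.
have reps a := coprime_class_rep hD (form_z a) idq normq idcf cf_level level_gt1.
have /choice[M] := reps => /choice[mu] /choice[m] repsP.
apply: (oldform_in_span hD hf hzH form_z hzdist hzall hchi hphi hcf hpull hr idq normq cbar_qcf
  (M := M) (mu := mu) (m := m)) => a; by case: (repsP a) => // ? ? ? ? [].
Qed.
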